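(* For every $c$ with $0<c<1$: (1) $F_B(c)\le c^2$. (2) $F(c)>\sqrt{1-c^2}$.
   Context: $\mathbb{D}=\{z\in\mathbb{C}:|z|<1\}$. The Bergman space $\mathcal{A}^2(\mathbb{D})$ is the set of analytic functions $f$ on $\mathbb{D}$ with $\|f\|_2=\left(\frac1\pi\int_{\mathbb{D}}|f(z)|^2\,dA(z)\right)^{1/2}<\infty$, where $dA$ is Lebesgue area measure. $S^1=\{f\in\mathcal{A}^2(\mathbb{D}):\|f\|_2=1\}$. Quotients $f/g$ are understood as meromorphic functions (common zeros cancelled, value $\infty$ at poles). For $0<c<1$, $$F(c)=\inf_{f,g\in S^1}\ \sup_{c\le|z|<1}\left|\frac{f(z)}{g(z)}\right|,\qquad F_B(c)=\sup_{(f,g)\in FG(c)}\left(\|f\|_2^2-\|g\|_2^2\right),$$ where $FG(c)$ is the set of pairs $f,g\in\mathcal{A}^2(\mathbb{D})$ with $\|f\|_2\le1$, $\|g\|_2\le1$ and $|f(z)|\le|g(z)|$ for all $z$ with $c\le|z|<1$. *)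

(* Defs.v *)
From HB Require Import structures.
From mathcomp Require Import all_boot all_order all_algebra.
From mathcomp Require Import all_classical all_reals all_analysis.
From mathcomp Require Import complex.
Set Implicit Arguments.
Unset Strict Implicit.
Unset Printing Implicit Defensive.
Import Order.TTheory GRing.Theory Num.Theory numFieldNormedType.Exports.
Import ComplexField.
Local Open Scope classical_set_scope.
Local Open Scope complex_scope.
Local Open Scope ring_scope.

Section Bergman.
Variable R : realType.
Implicit Types (f g u v : R[i] -> R[i]) (z w : R[i]) (c : R) (q : \bar R).

(* The modulus is [Normc.normc : R[i] -> R]; the generic norm `|z| of R[i]
   takes its values in R[i].  The regular-module cast ^o gives R[i] the
   topology of its norm. *)

Definition disk : set R[i] := [set z | Normc.normc z < 1].

Definition annulus c : set R[i] := [set z | c <= Normc.normc z < 1].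

(* Analyticity at z: f is the sum of a convergent power series centered at z
   on a neighborhood of z. *)
Definition analytic_at f z : Prop :=
  exists a : nat -> (R[i])^o, \forall w \near (z : (R[i])^o),
    series (fun k => a k * (w - z) ^+ k : (R[i])^o) @ \oo --> (f w : (R[i])^o).

(* Functions on the disk are represented by total functions; their values
   outside the disk are irrelevant everywhere below. *)
Definition analytic_on_disk f : Prop := forall z, disk z -> analytic_at f z.

(* dA is the product Lebesgue measure on R * R, with z = x + i y. *)
Definition bergman_norm f : \bar R :=
  (((pi^-1)%:E *
    \int[lebesgue_measure \x lebesgue_measure]_(p in
         [set p : R * R | disk (p.1 +i* p.2)])
      (Normc.normc (f (p.1 +i* p.2)) ^+ 2)%:E) `^ (2^-1))%E.

Definition bergman : set (R[i] -> R[i]) :=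
  [set f | analytic_on_disk f /\ (bergman_norm f < +oo)%E].

Definition bergman_sphere : set (R[i] -> R[i]) :=
  [set f | bergman f /\ bergman_norm f = 1%E].

(* q is the modulus at z of the meromorphic function f / g: near z, the common
   zero at z is cancelled by writing f = (w - z)^m u and g = (w - z)^m v with u
   and v not both zero at z; the value is u(z) / v(z), or oo if v(z) = 0.  Such
   a q exists at every point of the disk, and is unique, unless the analytic
   functions f and g both vanish identically. *)
Definition abs_quotient f g z q : Prop :=
  exists (m : nat) u v,
    [/\ analytic_at u z, analytic_at v z, (u z != 0) || (v z != 0),
        \forall w \near (z : (R[i])^o),
          f w = (w - z) ^+ m * u w /\ g w = (w - z) ^+ m * v w
      & q = if v z == 0 then +oo%E else (Normc.normc (u z / v z))%:E].

Definition sup_quotient c f g : \bar R :=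
  ereal_sup [set q | exists2 z, annulus c z & abs_quotient f g z q].

Definition F c : \bar R :=
  ereal_inf [set sup_quotient c fg.1 fg.2
            | fg in bergman_sphere `*` bergman_sphere].

Definition FG c : set ((R[i] -> R[i]) * (R[i] -> R[i])) :=
  [set fg | [/\ bergman fg.1, bergman fg.2,
                (bergman_norm fg.1 <= 1)%E, (bergman_norm fg.2 <= 1)%E
              & forall z, annulus c z ->
                  Normc.normc (fg.1 z) <= Normc.normc (fg.2 z)]].

Definition F_B c : \bar R :=
  ereal_sup [set (bergman_norm fg.1 ^+ 2 - bergman_norm fg.2 ^+ 2)%E
            | fg in FG c].

End Bergman.

(* Main.v *)
Require Import Defs.
From mathcomp Require Import all_boot all_order all_algebra.
From mathcomp Require Import all_classical all_reals all_analysis.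
From mathcomp Require Import cyclic separable cyclotomic.
From mathcomp Require Import measurable_realfun complex ring lra.

(** Let [mass f r] be the integral of the squared modulus of [f] over the disk of
radius [r].  If [f] is the sum of the [a k * z ^+ k], the powers of [z] are
orthogonal on this disk, and [mass f r] is the sum of the
[y k * (r ^+ 2) ^+ k.+1] with coefficients [y k >= 0] ([mass_series]).  Comparing
such series termwise gives two inequalities for [0 < t <= 1]: the contraction
[mass f (t * r) <= t ^+ 2 * mass f r] ([rmass_contract]), and a three circles
inequality, by which [mass f (t * r) ^+ 2] is at most
[mass f (t ^+ 2 * r) * mass f r] ([rmass_three_circles]).

If the modulus of [f] is at most that of [g] on the annulus, then
[mass f 1 - mass g 1] is at most [mass f c], and contraction gives the bound on
[F_B].

For [F], normalize both masses to 1 and let [M] bound the quotient on the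
annulus.  Comparing the masses of the annulus gives
[1 - mass f c <= M ^+ 2 * (1 - mass g c)], hence [M ^+ 2 >= 1 - c ^+ 2] by
contraction.  As [F] is an infimum, the strict inequality needs a gain that is
uniform in [f] and [g] ([ratio_dichotomy]).  If [mass g c] is not small, the
factor [1 - mass g c] is the gain.  If it is small, then [g] is small on a
somewhat larger disk by the three circles inequality, [f] is small between the
two circles because [M] controls it there, and contraction turns this into
smallness of [f] inside radius [c], which improves the bound [c ^+ 2] of
[mass f c].

The orthogonality and the Taylor series of [f] on the whole disk are obtained by
averaging over roots of unity.  On the analytic side the average gives Cauchy's
estimate for partial sums ([psum_coef_bound]); with re-expansion at neighbouring
points and compactness, this shows as in Weierstrass's theory that the Taylor
series at 0 converges to [f] on the disk ([disk_expands]).  On the side of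
integration it reduces the orthogonality to the invariance of area under
rotations ([mass_psum]), which are products of shears, so that it follows from
Tonelli's theorem and the translation invariance of Lebesgue measure. *)

Set Implicit Arguments.
Unset Strict Implicit.
Unset Printing Implicit Defensive.
Import Order.TTheory GRing.Theory Num.Theory numFieldNormedType.Exports.
Import ComplexField.
Local Open Scope classical_set_scope.
Local Open Scope complex_scope.
Local Open Scope ring_scope.

Local Notation normc := (@Normc.normc _).

(** * Modulus, convergence and roots of unity in the complex field *)

Section ComplexModulus.
Variable R : realType.
Implicit Types (z w : R[i]) (r : R).

Lemma normc_real r : normc r%:C = `|r|.
Proof. by rewrite /= expr0n /= addr0 sqrtr_sqr. Qed.

Lemma normrcE z : `|z| = (normc z)%:C.
Proof. by case: z. Qed.

Lemma normc_ge0 z : 0 <= normc z.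
Proof. by case: z => a b /=; exact: sqrtr_ge0. Qed.

Lemma normcD z w : normc (z + w) <= normc z + normc w.
Proof. exact: le_normcD. Qed.

Lemma normcB z w : normc (z - w) <= normc z + normc w.
Proof. by rewrite (le_trans (normcD _ _)) ?(normcN w). Qed.

Lemma normc_distC z w : normc (z - w) = normc (w - z).
Proof. by rewrite -[LHS](normcN (z - w)) opprB. Qed.

Lemma normc_eq0 z : (normc z == 0) = (z == 0).
Proof.
apply/eqP/eqP => [/Normc.eq0_normc //|->]; exact: Normc.normc0.
Qed.

Lemma normcX z n : normc (z ^+ n) = normc z ^+ n.
Proof.
elim: n => [|n IH]; first by rewrite !expr0 Normc.normc1.
by rewrite !exprS Normc.normcM IH.
Qed.

Lemma normc_sum (I : Type) (s : seq I) (P : pred I) (F : I -> R[i]) :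
  normc (\sum_(i <- s | P i) F i) <= \sum_(i <- s | P i) normc (F i).
Proof.
elim/big_rec2: _ => [|i y x _ H]; first by rewrite Normc.normc0.
by rewrite (le_trans (normcD _ _)) // lerD2l.
Qed.

Lemma sqr_normcE z : normc z ^+ 2 = complex.Re z ^+ 2 + complex.Im z ^+ 2.
Proof. by case: z => a b /=; rewrite sqr_sqrtr // addr_ge0 ?sqr_ge0. Qed.

Lemma sqr_normcC z : (normc z ^+ 2)%:C = z * z^*.
Proof. by rewrite -sqr_normc normrcE rmorphXn. Qed.

Lemma normc_Re z : `|complex.Re z| <= normc z.
Proof.
by rewrite -(ler_pXn2r (n:=2)) ?nnegrE ?normc_ge0 // sqr_normcE real_normK ?num_real //
  lerDl sqr_ge0.
Qed.

Lemma normc_Im z : `|complex.Im z| <= normc z.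
Proof.
by rewrite -(ler_pXn2r (n:=2)) ?nnegrE ?normc_ge0 // sqr_normcE real_normK ?num_real //
  lerDr sqr_ge0.
Qed.

Lemma normc_ReIm z : normc z <= `|complex.Re z| + `|complex.Im z|.
Proof.
rewrite -(ler_pXn2r (n:=2)) ?nnegrE ?normc_ge0 ?addr_ge0 // sqr_normcE sqrrD.
have : 0 <= `|complex.Re z| * `|complex.Im z| by exact: mulr_ge0.
rewrite !real_normK ?num_real //.
lra.
Qed.

(** The topology of [R[i]^o] is defined through balls of complex radius; the
two next lemmas restate it with the real modulus. *)
Lemma nearcP z (P : set R[i]) :
  (\forall w \near (z : R[i]^o), P w) <->
  exists2 e : R, 0 < e & forall w, normc (w - z) < e -> P w.
Proof.
split.
  move=> /nbhs_ballP [e /= e0 He].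
  have e0' : 0 < complex.Re e by move: e0; rewrite ltcE => /andP[_].
  exists (complex.Re e) => // w wz; apply: He => /=.
  rewrite -ball_normE /= distrC normrcE ltcE /= wz andbT.
  by move: e0; rewrite ltcE => /andP[/eqP ->].
move=> [e e0 He]; apply/nbhs_ballP; exists e%:C => /=; first by rewrite ltcR.
move=> w; rewrite -ball_normE /= distrC normrcE ltcR; exact: He.
Qed.

Lemma cvgcP (u : nat -> R[i]) z :
  ((u : nat -> R[i]^o) @ \oo --> (z : R[i]^o)) <->
  forall e : R, 0 < e -> exists N, forall n, (N <= n)%N -> normc (u n - z) < e.
Proof.
split.
  move=> /cvgrPdist_lt H e e0.
  have [|N _ HN] := H e%:C; first by rewrite ltcR.
  by exists N => n /HN /=; rewrite distrC normrcE ltcR.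
move=> H; apply/cvgrPdist_lt => e e0.
have e0' : 0 < complex.Re e by move: e0; rewrite ltcE => /andP[_].
have [N HN] := H _ e0'; exists N => // n /= /HN un.
rewrite distrC normrcE ltcE /= un andbT.
by move: e0; rewrite ltcE => /andP[/eqP ->].
Qed.

(** The real and imaginary parts are real Cauchy sequences.  The modulus of
convergence [E] passes to the limit, which keeps every later statement about
convergence quantitative. *)
Lemma cauchy_modulus (u : nat -> R[i]) (E : nat -> R) :
  (forall m n, (m <= n)%N -> normc (u n - u m) <= E m) -> E @ \oo --> (0 : R) ->
  exists l, forall m, normc (l - u m) <= E m.
Proof.
move=> uE E0.
have E0' e : 0 < e -> exists N, forall n, (N <= n)%N -> E n < e.
  move=> e0; move/cvgrPdist_lt: E0 => /(_ e e0)[N _ HN]; exists N => n /HN /=.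
  by rewrite sub0r normrN => /(le_lt_trans (ler_norm _)).
have part (p : R[i] -> R) : (forall z w, p (z - w) = p z - p w) ->
    (forall z, `|p z| <= normc z) -> exists l : R, (p \o u) @ \oo --> l.
  move=> pB pn; suff : cvgn (p \o u) by move=> H; exists (lim ((p \o u) @ \oo)).
  apply/cauchy_cvgP; apply: cauchy_exP => e e0.
  have [N HN] := E0' _ e0.
  exists (p (u N)), N => // n /= Nn; rewrite /ball /= -pB.
  rewrite (le_lt_trans (pn _)) // normc_distC (le_lt_trans (uE _ _ Nn)) //.
  exact: HN.
have [a ua] := part (@complex.Re R) (fun z w => ltac:(by case: z w => [? ?] [? ?])) normc_Re.
have [b ub] := part (@complex.Im R) (fun z w => ltac:(by case: z w => [? ?] [? ?])) normc_Im.
exists (a +i* b) => m; apply/ler_addgt0Pl => e e0.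
have e2 : 0 < e / 2 by rewrite divr_gt0.
move/cvgrPdist_lt: ua => /(_ _ e2) [Na _ Ha].
move/cvgrPdist_lt: ub => /(_ _ e2) [Nb _ Hb].
pose n := maxn m (maxn Na Nb).
rewrite -(subrK (u n) (a +i* b)) -addrA (le_trans (normcD _ _)) // lerD //; last first.
  by apply: uE; rewrite leq_maxl.
rewrite (le_trans (normc_ReIm _)) // [e]splitr ltW // ltrD //.
  have := Ha n; rewrite /= /n !leq_max leqnn !orbT => /(_ isT).
  by case: (u _).
have := Hb n; rewrite /= /n !leq_max leqnn !orbT => /(_ isT).
by case: (u _).
Qed.

(** The complex field is algebraically closed and ['X^n - 1] is separable. *)
Lemma prim_root_ex n : (0 < n)%N -> exists w : R[i], n.-primitive_root w.
Proof.
move=> n0; pose p : {poly R[i]} := 'X^n - 1.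
have [r Dp] := closed_field_poly_normal p.
move: Dp; rewrite (monicP _) ?monicXnsubC // scale1r => Dp.
have rn1 : all n.-unity_root r by apply/allP=> z; rewrite -root_prod_XsubC -Dp.
have sz_r : (n < (size r).+1)%N.
  by rewrite -(size_prod_XsubC r id) -Dp size_XnsubC.
have [|z] := hasP (has_prim_root n0 rn1 _ sz_r); last by exists z.
by rewrite -separable_prod_XsubC -Dp separable_Xn_sub_1 // pnatr_eq0 -lt0n.
Qed.

Lemma normc_prim_root n (w : R[i]) : (0 < n)%N -> n.-primitive_root w -> normc w = 1.
Proof.
move=> n0 /prim_expr_order wn1.
have : normc w ^+ n = 1 ^+ n by rewrite -normcX wn1 Normc.normc1 expr1n.
by move/eqP; rewrite eqrXn2 ?normc_ge0 // => /eqP.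
Qed.

End ComplexModulus.

(** * Power series with explicit bounds *)

Section PowerSeries.
Variable R : realType.
Implicit Types (a b : nat -> R[i]) (z w h : R[i]) (K d r s t : R).

Definition psum a n z := \sum_(k < n) a k * z ^+ k.

Definition tail K t n : R := K / (1 - t) * t ^+ n.

Lemma tail_cvg K t : 0 <= t -> t < 1 -> tail K t @ \oo --> (0 : R).
Proof. by move=> t0 t1; apply: cvg_geometric; rewrite ger0_norm. Qed.

Lemma tail_ge0 K t n : 0 <= K -> 0 <= t -> t < 1 -> 0 <= tail K t n.
Proof. by move=> K0 t0 t1; rewrite mulr_ge0 ?exprn_ge0 // divr_ge0 // subr_ge0 ltW. Qed.

Lemma leD_cvg0 (x y : R) (E : nat -> R) n0 : E @ \oo --> (0 : R) ->
  (forall n, (n0 <= n)%N -> x <= y + E n) -> x <= y.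
Proof.
move=> E0 H; apply/ler_addgt0Pl => e e0.
move/cvgrPdist_lt: E0 => /(_ e e0)[N _ HN].
rewrite (le_trans (H _ (leq_maxl n0 N))) // addrC lerD2r.
have := HN _ (leq_maxr n0 N); rewrite /= sub0r normrN => /ltW.
exact/le_trans/ler_norm.
Qed.

Lemma geom_sum_le t m n : 0 <= t -> t < 1 ->
  \sum_(m <= k < n) t ^+ k <= t ^+ m / (1 - t).
Proof.
move=> t0 t1; have t1' : 0 < 1 - t by rewrite subr_gt0.
have [nm|/ltnW mn] := leqP n m.
  by rewrite big_geq // divr_ge0 ?exprn_ge0 // ltW.
rewrite ler_pdivlMr //.
suff -> : (\sum_(m <= k < n) t ^+ k) * (1 - t) = t ^+ m - t ^+ n.
  by rewrite gerBl exprn_ge0.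
rewrite mulr_suml -(opprB (t ^+ n)) -(telescope_sumr _ mn) -sumrN.
by apply: eq_bigr => k _; rewrite exprSr mulrBr mulr1 opprB.
Qed.

Lemma psum_diff a m n z : (m <= n)%N ->
  psum a n z - psum a m z = \sum_(m <= k < n) a k * z ^+ k.
Proof.
move=> mn; rewrite /psum -!(big_mkord xpredT (fun k => a k * z ^+ k)).
by rewrite (big_cat_nat (leq0n m) mn) /= addrAC subrr add0r.
Qed.

Lemma psumB a b n z : psum a n z - psum b n z = psum (fun k => a k - b k) n z.
Proof. by rewrite /psum -sumrB; apply: eq_bigr => k _; rewrite mulrBl. Qed.

Definition coef_bound K d a := forall n, normc (a n) * d ^+ n <= K.

Lemma coef_bound_ge0 K d a : coef_bound K d a -> 0 <= K.
Proof. by move=> /(_ 0%N); rewrite mulr1; exact/le_trans/normc_ge0. Qed.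

Lemma psum_tail K d a z m n : 0 < d -> coef_bound K d a -> normc z < d ->
  (m <= n)%N -> normc (psum a n z - psum a m z) <= tail K (normc z / d) m.
Proof.
move=> d0 aK zd mn; have t0 : 0 <= normc z / d by rewrite divr_ge0 ?normc_ge0 // ltW.
have t1 : normc z / d < 1 by rewrite ltr_pdivrMr // mul1r.
rewrite psum_diff // (le_trans (normc_sum _ _ _)) //.
apply: (@le_trans _ _ (\sum_(m <= k < n) K * (normc z / d) ^+ k)).
  apply: ler_sum => k _; rewrite Normc.normcM normcX expr_div_n mulrA mulrAC.
  rewrite ler_wpM2r ?exprn_ge0 ?normc_ge0 // ler_pdivlMr ?exprn_gt0 //.
rewrite -mulr_sumr /tail mulrAC -mulrA ler_wpM2l ?(coef_bound_ge0 aK) //.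
exact: geom_sum_le.
Qed.

(** Convergence of the power series to [f] on the disk of centre [z0] and radius
[d].  The bound [K] on the terms is part of the data for two reasons: it has to
be uniform in [z0] when all points of a compact disk are treated together, and
it makes the speed of convergence explicit. *)
Definition expands K d a (f : R[i] -> R[i]) z0 :=
  coef_bound K d a /\ forall w, normc (w - z0) < d ->
    forall n, normc (f w - psum a n (w - z0)) <= tail K (normc (w - z0) / d) n.

Lemma expands_of_cvg K d a (f : R[i] -> R[i]) z0 : 0 < d -> coef_bound K d a ->
  (forall w, normc (w - z0) < d -> exists2 E : nat -> R, E @ \oo --> (0 : R) &
    forall n, normc (f w - psum a n (w - z0)) <= E n) ->
  expands K d a f z0.
Proof.
move=> d0 aK H; split=> // w wd n; have [E E0 HE] := H _ wd.
apply: (leD_cvg0 (n0 := n) E0) => m nm.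
rewrite [leRHS]addrC -(subrK (psum a m (w - z0)) (f w)) -addrA.
rewrite (le_trans (normcD _ _)) // lerD //; exact: psum_tail.
Qed.

Lemma expands_sum K d a : 0 < d -> coef_bound K d a ->
  exists g, expands K d a g 0.
Proof.
move=> d0 aK.
have H w : exists l, normc w < d ->
    forall n, normc (l - psum a n w) <= tail K (normc w / d) n.
  have [wd|] := boolP (normc w < d); last by exists 0.
  have [|l Hl] := cauchy_modulus (fun m n => psum_tail d0 aK wd (n:=n) (m:=m)).
    apply: tail_cvg; first by rewrite divr_ge0 ?normc_ge0 // ltW.
    by rewrite ltr_pdivrMr // mul1r.
  by exists l.
by have [g Hg] := choice H; exists g; split => // w; rewrite subr0; exact: Hg.
Qed.

Lemma expands_shrink K d d' a (f : R[i] -> R[i]) z0 : 0 < d' -> d' <= d ->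
  expands K d a f z0 -> expands K d' a f z0.
Proof.
move=> d'0 dd [aK H]; have d0 := lt_le_trans d'0 dd.
apply: expands_of_cvg => //.
  move=> n; rewrite (le_trans _ (aK n)) // ler_wpM2l ?normc_ge0 //.
  by rewrite lerXn2r ?nnegrE // ltW.
move=> w wd; exists (tail K (normc (w - z0) / d)).
  apply: tail_cvg; first by rewrite divr_ge0 ?normc_ge0 // ltW.
  by rewrite ltr_pdivrMr // mul1r (lt_le_trans wd).
exact/H/(lt_le_trans wd).
Qed.

(** Powers of distinct orders below [N] are orthogonal on the [N]-th roots of
unity: for [k != l] the sum is geometric of ratio [x ^+ k / x ^+ l != 1]. *)
Lemma sum_prim_root N (x : R[i]) k l : N.-primitive_root x ->
  (k < N)%N -> (l < N)%N ->
  \sum_(j < N) (x ^+ j) ^+ k * ((x ^+ j) ^+ l)^* = (N * (k == l))%:R.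
Proof.
move=> px kN lN; have N0 : (0 < N)%N by apply: leq_ltn_trans kN.
have x1 := normc_prim_root N0 px.
have xJ : x^* = x^-1 by rewrite invc_norm normrcE x1 expr1n invr1 mul1r.
have x0 : x != 0 by rewrite -normc_eq0 x1 oner_eq0.
pose y := x ^+ k / x ^+ l.
rewrite (eq_bigr (fun j : 'I_N => y ^+ j)); last first.
  move=> j _; rewrite !rmorphXn /= xJ /y expr_div_n -!exprVn -!exprM.
  by rewrite mulnC (mulnC j l).
have [kl|kl] := eqVneq k l.
  rewrite muln1 /y kl divff ?expf_neq0 // (eq_bigr (fun=> 1)) => [|j _]; last by rewrite expr1n.
  by rewrite sumr_const card_ord.
have y1 : y != 1.
  apply: contra kl => /eqP y1; have := prim_expr_order px.
  have : x ^+ k = x ^+ l by rewrite -[LHS](divfK (expf_neq0 l x0)) -/y y1 mul1r.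
  by move/eqP; rewrite (eq_prim_root_expr px) /= !modn_small.
have : y ^+ N - 1 = (y - 1) * \sum_(j < N) y ^+ j by rewrite -subrX1.
rewrite muln0 /y expr_div_n -!exprM !(mulnC _ N) !exprM (prim_expr_order px).
rewrite !expr1n divr1 subrr => /esym/eqP; rewrite mulf_eq0 subr_eq0 (negbTE y1) /=.
by move/eqP.
Qed.

Lemma discrete_parseval N (x : R[i]) a z : N.-primitive_root x ->
  \sum_(j < N) normc (psum a N (x ^+ j * z)) ^+ 2 =
  N%:R * \sum_(k < N) normc (a k) ^+ 2 * normc z ^+ (2 * k).
Proof.
move=> px; apply: complexI; rewrite /= rmorph_sum rmorphM rmorph_nat rmorph_sum /=.
under eq_bigr => j _.
  rewrite sqr_normcC /psum rmorph_sum /= big_distrlr /=.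
over.
rewrite exchange_big /= mulr_sumr; apply: eq_bigr => k _.
rewrite exchange_big /= (bigD1 k) //= [X in _ + X]big1 ?addr0; last first.
  move=> l lk; rewrite (eq_bigr (fun j : 'I_N => (a k * z ^+ k * (a l * z ^+ l)^*) *
     ((x ^+ j) ^+ k * ((x ^+ j) ^+ l)^*))); last first.
    move=> j _; rewrite !exprMn !rmorphM /=; ring.
  rewrite -mulr_sumr sum_prim_root // (_ : _ == _ = false) ?muln0 ?mulr0 //.
  by apply/negbTE; rewrite eq_sym.
rewrite (eq_bigr (fun j : 'I_N => (a k * z ^+ k * (a k * z ^+ k)^*) *
     ((x ^+ j) ^+ k * ((x ^+ j) ^+ k)^*))); last first.
  move=> j _; rewrite !exprMn !rmorphM /=; ring.
rewrite -mulr_sumr sum_prim_root // eqxx muln1 mulrC; congr (_ * _).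
by rewrite -sqr_normcC Normc.normcM normcX exprMn -exprM mulnC.
Qed.

(** Cauchy's estimate without a contour integral: one term of Parseval's sum is
at most the mean of the squared moduli over the roots of unity. *)
Lemma psum_coef_bound N a r (B : R) n : 0 <= r ->
  (forall z, normc z = r -> normc (psum a N z) <= B) ->
  (n < N)%N -> normc (a n) * r ^+ n <= B.
Proof.
move=> r0 aB nN; have N0 : (0 < N)%N by apply: leq_ltn_trans nN.
have [x px] := @prim_root_ex R _ N0.
have B0 : 0 <= B.
  apply: (le_trans (normc_ge0 _) (aB r%:C _)).
  by rewrite normc_real ger0_norm.
rewrite -(ler_pXn2r (n:=2)) ?nnegrE ?mulr_ge0 ?exprn_ge0 ?normc_ge0 //.
have N0' : 0 < N%:R :> R by rewrite ltr0n.
rewrite -(ler_pM2l N0').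
apply: (@le_trans _ _ (\sum_(j < N) normc (psum a N (x ^+ j * r%:C)) ^+ 2)).
  rewrite (discrete_parseval _ _ px) ler_pM2l // (bigD1 (Ordinal nN)) //.
  rewrite -[leLHS]addr0 lerD //.
    by rewrite exprMn -exprM mulnC normc_real ger0_norm.
  by apply: sumr_ge0 => k _; rewrite mulr_ge0 ?exprn_ge0 ?normc_ge0.
apply: (@le_trans _ _ (\sum_(j < N) B ^+ 2)); last by rewrite sumr_const card_ord mulr_natl.
apply: ler_sum => j _; rewrite lerXn2r ?nnegrE ?normc_ge0 // aB //.
by rewrite Normc.normcM normcX (normc_prim_root N0 px) expr1n mul1r normc_real ger0_norm.
Qed.

(** Cauchy's estimate for the difference of the two series, whose partial sums
tend to zero on a small circle. *)
Lemma expands_unique K1 K2 d1 d2 e a b (f g : R[i] -> R[i]) z0 : 0 < d1 -> 0 < d2 -> 0 < e ->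
  expands K1 d1 a f z0 -> expands K2 d2 b g z0 ->
  (forall w, normc (w - z0) < e -> f w = g w) -> a = b.
Proof.
move=> d10 d20 e0 [aK Hf] [bK Hg] fg; apply/funext => n.
pose m := Num.min e (Num.min d1 d2).
have m0 : 0 < m by rewrite !lt_min e0 d10.
pose r := m / 2; have r0 : 0 < r by rewrite divr_gt0.
have rm : r < m by rewrite /r; lra.
have [re rd1 rd2] : [/\ r < e, r < d1 & r < d2].
  by move: rm; rewrite /m !lt_min => /andP[-> /andP[-> ->]].
apply/eqP; rewrite -subr_eq0 -normc_eq0 eq_le normc_ge0 andbT.
rewrite -(pmulr_lle0 _ (exprn_gt0 n r0)).
have t0 d : 0 < d -> 0 <= r / d by move=> d0; rewrite divr_ge0 // ltW.
have t1 d : 0 < d -> r < d -> r / d < 1 by move=> d0 rd; rewrite ltr_pdivrMr // mul1r.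
apply: (@leD_cvg0 _ _ (fun N => tail K1 (r / d1) N + tail K2 (r / d2) N) n.+1).
  by rewrite -[X in _ --> X]addr0; apply: cvgD; apply: tail_cvg; auto.
move=> N nN; rewrite add0r.
apply: (@psum_coef_bound N (fun k => a k - b k)) => //; first exact: ltW.
move=> z zr; rewrite -psumB.
have wz : (z + z0) - z0 = z by rewrite addrK.
have fgz : f (z + z0) = g (z + z0) by apply: fg; rewrite wz zr.
rewrite -(subrK (f (z + z0)) (psum a N z)) -addrA (le_trans (normcD _ _)) // lerD //.
  by have := Hf (z + z0); rewrite wz zr normc_distC; apply.
by have := Hg (z + z0); rewrite wz zr fgz; apply.
Qed.

(** Re-expansion at [h]: [shift a h M] lists the coefficients of the polynomial
[psum a M (h + w)] in the variable [w]. *)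
Definition shift a h M n := \sum_(m < M) (a m * h ^+ (m - n)) *+ 'C(m, n).

Lemma exprD_bin (A : comPzRingType) (x y : A) m M : (m < M)%N ->
  (x + y) ^+ m = \sum_(n < M) (x ^+ (m - n) * y ^+ n) *+ 'C(m, n).
Proof.
move=> mM; rewrite exprDn.
rewrite -(big_mkord xpredT (fun n => (x ^+ (m - n) * y ^+ n) *+ 'C(m, n))).
rewrite -(big_mkord xpredT (fun n => (x ^+ (m - n) * y ^+ n) *+ 'C(m, n))).
rewrite (big_cat_nat (n := m.+1) (p := M)) //= [X in _ + X]big_nat_cond.
rewrite [X in _ + X]big1 ?addr0 //.
by move=> i /andP[/andP[mi _] _]; rewrite bin_small.
Qed.

Lemma psum_shift a h M w : psum a M (h + w) = psum (shift a h M) M w.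
Proof.
rewrite /psum /shift.
under [RHS]eq_bigr => n _ do rewrite mulr_suml.
rewrite exchange_big /=; apply: eq_bigr => m _.
rewrite (exprD_bin _ _ (ltn_ord m)) mulr_sumr; apply: eq_bigr => n _.
by rewrite mulrnAr mulrnAl mulrA.
Qed.

Lemma bin_le (r s : R) m n : 0 <= r -> 0 <= s ->
  (r ^+ (m - n) * s ^+ n) *+ 'C(m, n) <= (r + s) ^+ m.
Proof.
move=> r0 s0; have [mn|nm] := ltnP m n.
  by rewrite bin_small // mulr0n exprn_ge0 // addr_ge0.
rewrite exprDn (bigD1 (Ordinal (nm : (n < m.+1)%N))) //= lerDl.
by apply: sumr_ge0 => i _; rewrite mulrn_wge0 // mulr_ge0 ?exprn_ge0.
Qed.

(** The weight [s ^+ n] makes the bound independent of [n]: by the binomial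
theorem each monomial of degree [m] contributes at most [(normc h + s) ^+ m]. *)
Lemma shift_tail K d a h s n M M' : 0 < d -> coef_bound K d a -> 0 <= s ->
  normc h + s < d -> (M <= M')%N ->
  normc (shift a h M' n - shift a h M n) * s ^+ n <= tail K ((normc h + s) / d) M.
Proof.
move=> d0 aK s0 hs MM; set t := _ / d.
have hs0 : 0 <= normc h + s by rewrite addr_ge0 ?normc_ge0.
have t0 : 0 <= t by rewrite divr_ge0 // ltW.
have t1 : t < 1 by rewrite ltr_pdivrMr // mul1r.
have -> : shift a h M' n - shift a h M n =
    \sum_(M <= m < M') (a m * h ^+ (m - n)) *+ 'C(m, n).
  rewrite /shift -!(big_mkord xpredT (fun m => (a m * h ^+ (m - n)) *+ 'C(m, n))).
  by rewrite (big_cat_nat (leq0n M) MM) /= addrAC subrr add0r.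
rewrite (le_trans (ler_wpM2r _ (normc_sum _ _ _))) ?exprn_ge0 // mulr_suml.
apply: (@le_trans _ _ (\sum_(M <= m < M') K * t ^+ m)); last first.
  rewrite -mulr_sumr /tail mulrAC -mulrA ler_wpM2l ?(coef_bound_ge0 aK) //.
  exact: geom_sum_le.
apply: ler_sum => m _; rewrite normcMn Normc.normcM normcX.
rewrite mulrnAl -mulrA -mulrnAr.
rewrite (le_trans (ler_wpM2l (normc_ge0 _) (bin_le _ _ (normc_ge0 _) s0))) //.
by rewrite /t expr_div_n mulrA mulrAC ler_wpM2r ?exprn_ge0 // ler_pdivlMr ?exprn_gt0.
Qed.

(** Taylor expansion at a neighbouring point.  No double series is rearranged:
the polynomials [psum a M] are re-expanded, and [shift_tail] lets [M] go to
infinity uniformly in the degree. *)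
Lemma reexpand K d a h s : 0 < d -> coef_bound K d a -> 0 < s ->
  normc h + s < d ->
  exists b, [/\
    forall M n, normc (b n - shift a h M n) * s ^+ n <= tail K ((normc h + s) / d) M &
    forall f z0, expands K d a f z0 ->
      expands (tail K ((normc h + s) / d) 0) s b f (z0 + h)].
Proof.
move=> d0 aK s0 hs; set t := _ / d.
have hs0 : 0 <= normc h + s by rewrite addr_ge0 ?normc_ge0 // ltW.
have t0 : 0 <= t by rewrite divr_ge0 // ltW.
have t1 : t < 1 by rewrite ltr_pdivrMr // mul1r.
have H n : exists l, forall M, normc (l - shift a h M n) <= tail K t M / s ^+ n.
  apply: cauchy_modulus => [M M' MM|].
    by rewrite ler_pdivlMr ?exprn_gt0 // shift_tail // ltW.
  by rewrite -(mul0r (s ^+ n)^-1); apply: cvgMr_tmp; apply: tail_cvg.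
have [b Hb] := choice H; exists b.
have bs M n : normc (b n - shift a h M n) * s ^+ n <= tail K t M.
  by rewrite -ler_pdivlMr ?exprn_gt0 // Hb.
split=> // f z0 [_ Hf]; apply: expands_of_cvg => //.
  by move=> n; have := bs 0%N n; rewrite /shift big_ord0 subr0.
move=> w ws; set y := w - (z0 + h) in ws *.
have wy : w - z0 = h + y by rewrite /y; ring.
have yd : normc (w - z0) < d.
  by rewrite wy (le_lt_trans (normcD _ _)) // (lt_trans _ hs) // ltrD2l.
have ys0 : 0 <= normc y / s by rewrite divr_ge0 ?normc_ge0 // ltW.
have ys1 : normc y / s < 1 by rewrite ltr_pdivrMr // mul1r.
exists (fun n => tail K (normc (w - z0) / d) n + tail K t n * (1 / (1 - normc y / s))).
  rewrite [X in _ --> X](_ : 0 = 0 + 0 * (1 / (1 - normc y / s))); last first.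
    by rewrite mul0r addr0.
  apply: cvgD; last by apply: cvgMr_tmp; exact: tail_cvg.
  apply: tail_cvg; first by rewrite divr_ge0 ?normc_ge0 // ltW.
  by rewrite ltr_pdivrMr // mul1r.
move=> n; rewrite -(subrK (psum a n (w - z0)) (f w)) -addrA.
rewrite (le_trans (normcD _ _)) // lerD //; first exact: Hf.
rewrite wy psum_shift normc_distC psumB /psum (le_trans (normc_sum _ _ _)) //.
apply: (@le_trans _ _ (\sum_(0 <= k < n) tail K t n * (normc y / s) ^+ k)).
  rewrite big_mkord; apply: ler_sum => k _; rewrite Normc.normcM normcX.
  rewrite expr_div_n mulrA mulrAC ler_wpM2r ?exprn_ge0 ?normc_ge0 //.
rewrite -mulr_sumr ler_wpM2l ?tail_ge0 ?(coef_bound_ge0 aK) //.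
by rewrite (le_trans (geom_sum_le _ _ _ _)) ?expr0.
Qed.

End PowerSeries.

(** * Global Taylor expansion on the disk *)

Section TaylorOnDisk.
Variable R : realType.
Implicit Types (a b : nat -> R[i]) (f g : R[i] -> R[i]) (z w h : R[i]) (K d r s : R).

Lemma expands_weaken K K' d a f z : 0 < d -> K <= K' -> expands K d a f z ->
  expands K' d a f z.
Proof.
move=> d0 KK [aK H]; split=> [n|w wd n]; first exact: le_trans (aK n) KK.
rewrite (le_trans (H _ wd n)) // /tail ler_wpM2r ?exprn_ge0 ?divr_ge0 ?normc_ge0 ?(ltW d0) //.
by rewrite ler_wpM2r // invr_ge0 subr_ge0 ler_pdivrMr // mul1r ltW.
Qed.

Lemma expands_eq K1 K2 d1 d2 a f g z0 w : 0 < d1 -> 0 < d2 ->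
  expands K1 d1 a f z0 -> expands K2 d2 a g z0 ->
  normc (w - z0) < d1 -> normc (w - z0) < d2 -> f w = g w.
Proof.
move=> d10 d20 [_ Hf] [_ Hg] wd1 wd2; apply/eqP.
rewrite -subr_eq0 -normc_eq0 eq_le normc_ge0 andbT.
apply: (@leD_cvg0 _ _ _ (fun N => tail K1 (normc (w - z0) / d1) N +
                                 tail K2 (normc (w - z0) / d2) N) 0%N).
  rewrite -[X in _ --> X]addr0; apply: cvgD; apply: tail_cvg.
  - by rewrite divr_ge0 ?normc_ge0 ?(ltW d10).
  - by rewrite ltr_pdivrMr // mul1r.
  - by rewrite divr_ge0 ?normc_ge0 ?(ltW d20).
  - by rewrite ltr_pdivrMr // mul1r.
move=> N _; rewrite add0r -(subrK (psum a N (w - z0)) (f w)) -addrA.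
apply: le_trans (normcD _ _) _; apply: lerD; first exact: Hf.
by rewrite (normc_distC _ (g w)); exact: Hg.
Qed.

Lemma analytic_expands f z : analytic_at f z ->
  exists K d a, 0 < d /\ expands K d a f z.
Proof.
move=> [a /nearcP [e e0 H]].
have {}H w : normc (w - z) < e ->
    forall x : R, 0 < x -> exists N, forall n, (N <= n)%N -> normc (psum a n (w - z) - f w) < x.
  move=> /H /cvgcP {}H x /H [N HN]; exists N => n /HN.
  by rewrite /series /= big_mkord.
pose d := e / 2; have d0 : 0 < d by rewrite divr_gt0.
have de : d < e by rewrite /d; lra.
have wd : z + d%:C - z = d%:C by rewrite addrC addKr.
have [|N HN] := H (z + d%:C) _ 1 ltr01; first by rewrite wd normc_real gtr0_norm.
rewrite wd in HN.
pose K := 2 + \sum_(k < N) normc (a k) * d ^+ k.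
have S0 : 0 <= \sum_(k < N) normc (a k) * d ^+ k.
  by apply: sumr_ge0 => k _; rewrite mulr_ge0 ?normc_ge0 ?exprn_ge0 ?ltW.
have aK : coef_bound K d a.
  move=> n; have [nN|Nn] := ltnP n N.
    rewrite /K (bigD1 (Ordinal nN)) //= addrCA lerDl addr_ge0 //.
    by apply: sumr_ge0 => k _; rewrite mulr_ge0 ?normc_ge0 ?exprn_ge0 ?ltW.
  have -> : normc (a n) * d ^+ n = normc (psum a n.+1 d%:C - psum a n d%:C).
    rewrite /psum big_ord_recr /= addrAC subrr add0r Normc.normcM normcX.
    by rewrite (normc_real d) gtr0_norm.
  have h1 := HN _ (leqW Nn); have h2 := HN _ Nn.
  have := normcB (psum a n.+1 d%:C - f (z + d%:C)) (psum a n d%:C - f (z + d%:C)).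
  rewrite opprB addrA subrK /K => h3; lra.
exists K, d, a; split=> //; apply: expands_of_cvg => // w wdd.
exists (fun n => normc (f w - psum a n (w - z))) => //.
apply/cvgrPdist_lt => x x0; have [M HM] := H w (lt_trans wdd de) x x0.
exists M => // n /= /HM; rewrite sub0r normrN ger0_norm ?normc_ge0 //.
by rewrite normc_distC.
Qed.

(** Compactness of the closed disk, in the form that turns local bounds into
uniform ones. *)
Lemma closed_disk_uniform (P : nat -> R[i] -> Prop) r :
  (forall m n z, (m <= n)%N -> P m z -> P n z) ->
  (forall z, normc z <= r -> exists N, exists2 e, 0 < e &
     forall w, normc (w - z) < e -> P N w) ->
  exists N, forall z, normc z <= r -> P N z.
Proof.
move=> Pmono Ploc.
have cK : compact (`[- r, r]%classic `*` `[- r, r]%classic : set (R * R)).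
  by apply: compact_setX; exact: segment_compact.
move/compact_near_coveringP : cK => /(_ nat \oo
  (fun n p => normc (p.1 +i* p.2) <= r -> P n (p.1 +i* p.2)) _) H.
have key e (p q : R * R) : ball p (e / 2) q ->
    normc ((q.1 +i* q.2) - (p.1 +i* p.2)) < e.
  move=> [b1 b2]; rewrite (le_lt_trans (normc_ReIm _)) //= [e]splitr ltrD //.
    by move: b1; rewrite -ball_normE /= distrC.
  by move: b2; rewrite -ball_normE /= distrC.
case: H => [p _ |N _ HN].
  have [pr|rp] := leP (normc (p.1 +i* p.2)) r.
    have [N [e e0 He]] := Ploc _ pr.
    exists (ball p (e / 2), [set n | (N <= n)%N]).
      by split; [apply: nbhsx_ballx; rewrite divr_gt0 | exists N].
    move=> [q n] /= [qp Nn] _; apply: (Pmono N) => //; apply: He; exact: key.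
  pose e := normc (p.1 +i* p.2) - r; have e0 : 0 < e by rewrite subr_gt0.
  exists (ball p (e / 2), setT).
    by split; [apply: nbhsx_ballx; rewrite divr_gt0 | exact: filterT].
  move=> [q n] [qp _] qr; exfalso.
  have := key _ _ _ qp; rewrite normc_distC => h1.
  have := normcD ((p.1 +i* p.2) - (q.1 +i* q.2)) (q.1 +i* q.2).
  rewrite subrK => h2; move: h1; rewrite /e => h1; lra.
exists N => -[x y] zr; apply: (HN N (leqnn N) (x, y)) => //=.
by rewrite !in_itv /= -!ler_norml (le_trans (normc_Re (x +i* y))) ?(le_trans (normc_Im (x +i* y))).
Qed.

(** Near a point [z] with an expansion of radius [d], re-expansion gives radius
[d / 4] with constant [2 * K]; compactness then gives one radius and one
constant for the whole closed disk. *)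
Lemma uniform_expands f r : r < 1 -> analytic_on_disk f ->
  exists K d, 0 < d /\ forall z, normc z <= r -> exists b, expands K d b f z.
Proof.
move=> r1 fan.
have [|z zr|N HN] := @closed_disk_uniform
    (fun N z => exists b, expands N%:R (N.+1%:R^-1) b f z) r.
- move=> m n z mn [b Hb]; exists b.
  have i0 k : 0 < k.+1%:R^-1 :> R by rewrite invr_gt0 ltr0n.
  apply: (expands_weaken (i0 n) (K := m%:R)); first by rewrite ler_nat.
  apply: expands_shrink Hb => //; by rewrite lef_pV2 ?posrE ?ltr0n // ler_nat ltnS.
- have [|K [d [a [d0 H]]]] := @analytic_expands f z.
    by apply: fan; exact: le_lt_trans zr r1.
  pose s := d / 4; have s0 : 0 < s by rewrite divr_gt0.
  have [aK _] := H; have K0 := coef_bound_ge0 aK.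
  have [n [nK nd]] : exists n : nat, 2 * K <= n%:R /\ s^-1 <= n.+1%:R.
    exists (Num.bound (Num.max (2 * K) s^-1)); split.
      rewrite (le_trans _ (ltW (archi_boundP _))) // ?le_max ?lexx //.
      by rewrite mulr_ge0.
    rewrite -addn1 natrD ler_wpDr // (le_trans _ (ltW (archi_boundP _))) //.
      by rewrite le_max lexx orbT.
    by rewrite le_max mulr_ge0.
  exists n, s => // w ws; pose h := w - z.
  have hs : normc h + s < d by rewrite /s in ws *; rewrite -/h in ws; lra.
  have [b [_ /(_ _ _ H)]] := reexpand d0 aK s0 hs.
  rewrite (_ : z + h = w); last by rewrite /h addrC subrK.
  move=> Hb; exists b.
  have i0 : 0 < n.+1%:R^-1 :> R by rewrite invr_gt0 ltr0n.
  apply: (expands_shrink i0 (d := s)).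
    by rewrite -[leRHS]invrK lef_pV2 ?posrE ?invr_gt0 ?ltr0n.
  apply: expands_weaken Hb => //; rewrite /tail mulr1 (le_trans _ nK) //.
  have t2 : (normc h + s) / d <= 2^-1.
    by rewrite ler_pdivrMr //; rewrite /s in ws *; rewrite -/h in ws; lra.
  rewrite ler_pdivrMr; last by lra.
  rewrite mulrAC ler_peMl //; lra.
- exists N%:R, N.+1%:R^-1; split; first by rewrite invr_gt0 ltr0n.
  exact: HN.
Qed.

Lemma shift_psum a h k N :
  shift a h (N + k) k = psum (fun j => a (j + k)%N *+ 'C(j + k, k)) N h.
Proof.
rewrite /shift -(big_mkord xpredT (fun m => (a m * h ^+ (m - k)) *+ 'C(m, k))).
rewrite (big_cat_nat (leq0n k) (leq_addl N k)) /= big_nat_cond big1 ?add0r; last first.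
  by move=> i /andP[/andP[_ ik] _]; rewrite bin_small.
rewrite -{1}[k]add0n big_addn addnK big_mkord; apply: eq_bigr => j _.
by rewrite addnK mulrnAl.
Qed.

(** The coefficients of the re-expansions of [f] at the points of a circle are
power series in these points.  Hence uniform bounds for the re-expansions
bound, through Cauchy's estimate, the binomial expansion of
[a n * (r + d / 4) ^+ n]. *)
Lemma expands_extend K0 K r d a f : 0 < d -> d <= r -> expands K0 r a f 0 ->
  (forall z, normc z < r -> exists b, expands K d b f z) ->
  exists K', expands K' (r + d / 4) a f 0.
Proof.
move=> d0 dr Ha Hb; have r0 : 0 < r := lt_le_trans d0 dr.
pose r' := r - d / 4; have r'0 : 0 < r' by rewrite /r'; lra.
have r'r : r' < r by rewrite /r'; lra.
have [aK _] := Ha.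
(* Cauchy's estimate in the variable [z], on the circle of radius [r'], for the
     coefficient of order [k] at [z], which [K / d ^+ k] bounds. *)
have bnd k j : normc (a (j + k)%N *+ 'C(j + k, k)) * r' ^+ j <= K / d ^+ k.
  pose s := d / 8; have s0 : 0 < s by rewrite divr_gt0.
  have r's : r' + s < r by rewrite /r' /s; lra.
  apply: (@leD_cvg0 _ _ _ (fun M => tail K0 ((r' + s) / r) (M + k) / s ^+ k) j.+1).
    rewrite -(mul0r (s ^+ k)^-1); apply: cvgMr_tmp.
    rewrite (cvg_shiftn k); apply: tail_cvg.
      by rewrite divr_ge0 ?(ltW r0) // addr_ge0 // ltW.
    by rewrite ltr_pdivrMr // mul1r.
  move=> M jM; apply: (@psum_coef_bound _ M (fun j => a (j + k)%N *+ 'C(j + k, k))) => //.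
    exact: ltW.
  move=> z zr; have zs : normc z + s < r by rewrite zr.
  have [c [cM /(_ _ _ Ha)]] := reexpand r0 aK s0 zs; rewrite add0r => Hc.
  have [|b Hbz] := Hb z; first by rewrite zr.
  have bc : b = c by apply: (expands_unique d0 s0 ltr01 Hbz Hc).
  rewrite -shift_psum -[shift _ _ _ _](subrKC (c k)).
  rewrite (le_trans (normcD _ _)) // lerD //.
    by rewrite ler_pdivlMr ?exprn_gt0 // -bc; case: Hbz => /(_ k).
  by rewrite ler_pdivlMr ?exprn_gt0 // normc_distC -zr; exact: cM.
have r0' : 0 < r + d / 4 by lra.
(* [r + d / 4 = r' + d / 2], and the binomial terms are at most [K / 2 ^+ k]. *)
have aK' : coef_bound (2 * K) (r + d / 4) a.
  move=> n; have -> : r + d / 4 = r' + d / 2 by rewrite /r'; lra.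
  rewrite exprDn mulr_sumr.
  apply: (@le_trans _ _ (\sum_(0 <= k < n.+1) K * 2^-1 ^+ k)).
    rewrite big_mkord; apply: ler_sum => k _.
    have kn : (k <= n)%N by rewrite -ltnS.
    have := bnd k (n - k)%N; rewrite subnK // normcMn ler_pdivlMr ?exprn_gt0 // => H.
    apply: le_trans (ler_wpM2r (exprn_ge0 k _) H); last by rewrite invr_ge0.
    rewrite le_eqVlt; apply/orP; left; apply/eqP.
    have alg (u v x y c : R) : u * (v * (x * y) * c) = u * c * v * x * y by ring.
    by rewrite exprMn -[normc _ *+ _]mulr_natr -[(_ * _) *+ _]mulr_natr alg.
  have K0' : 0 <= K.
    by have [|b [/coef_bound_ge0]] := Hb 0; rewrite ?Normc.normc0.
  rewrite -mulr_sumr mulrC ler_wpM2r //.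
  have h1 : 1 - 2^-1 = 2^-1 :> R by lra.
  apply: le_trans (geom_sum_le _ _ _ _) _; rewrite ?invr_ge0 //; first by lra.
  by rewrite h1 expr0 invrK mul1r.
have [g Hg] := expands_sum r0' aK'.
exists (2 * K); split => // w; rewrite subr0 => wr n.
suff -> : f w = g w by case: Hg => _ /(_ w); rewrite subr0; apply.
have fg v : normc v < r -> f v = g v.
  by move=> vr; apply: (expands_eq r0 r0' Ha Hg); rewrite subr0 //; lra.
have [wr0|rw] := ltP (normc w) r; first exact: fg.
have w0 : 0 < normc w by apply: lt_le_trans rw.
(* The point of the circle of radius [r'] on the ray through [w]: both series,
   re-expanded there, converge at [w]. *)
pose z := (r' / normc w)%:C * w.
have zr : normc z = r'.
  by rewrite Normc.normcM normc_real ger0_norm ?divfK ?gt_eqF // divr_ge0 ?ltW.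
have wz : normc (w - z) = normc w - r'.
  rewrite (_ : w - z = (1 - r' / normc w)%:C * w); last first.
    rewrite /z -{1}[w]mul1r -mulrBl; congr (_ * w).
    by apply/eqP; rewrite eq_complex /= subrr !eqxx.
  rewrite Normc.normcM normc_real ger0_norm.
    by rewrite mulrBl mul1r divfK // gt_eqF.
  by rewrite subr_ge0 ler_pdivrMr // mul1r (le_trans (ltW r'r)).
pose s := (normc w - r' + d / 2) / 2.
have ws : normc (w - z) < s by rewrite wz /s /r'; lra.
have s0 : 0 < s by apply: le_lt_trans ws; exact: normc_ge0.
have zs : normc z + s < r + d / 4 by rewrite zr /s /r'; lra.
have [c [_ /(_ _ _ Hg)]] := reexpand r0' aK' s0 zs; rewrite add0r => Hc.
have [|b Hbz] := Hb z; first by rewrite zr.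
have e0 : 0 < d / 4 by rewrite divr_gt0.
have bc : b = c.
  apply: (expands_unique d0 s0 e0 Hbz Hc) => v vz; apply: fg.
  rewrite -(subrK z v) (le_lt_trans (normcD _ _)) // zr /r'; lra.
rewrite bc in Hbz.
by apply: (expands_eq d0 s0 Hbz Hc) => //; rewrite wz /r'; lra.
Qed.

(** Analyticity is a local condition; it yields a global series because, were the
supremum [q] of the admissible radii less than 1, [expands_extend] with the
bounds uniform on the closed disk of radius [q] would go beyond [q]. *)
Lemma disk_expands_lt f r : analytic_on_disk f -> 0 < r -> r < 1 ->
  exists K a, expands K r a f 0.
Proof.
move=> fan r0 r1.
pose S : set R := [set s | [/\ 0 < s, s <= 1 & exists K a, expands K s a f 0]].
have [|K1 [d1 [a1 [d10 H1]]]] := @analytic_expands f 0.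
  by apply: fan; rewrite /disk /mkset Normc.normc0.
have S1 : S (Num.min 1 d1).
  split; rewrite ?lt_min ?ltr01 ?ge_min ?lexx //.
  exists K1, a1; apply: expands_shrink H1; rewrite ?lt_min ?ltr01 ?ge_min ?lexx ?orbT //.
have hS : has_sup S.
  by split; [exists (Num.min 1 d1) | exists 1 => s [_ s1 _]].
have [[s [Ss rs]]|Hno] := pselect (exists s, S s /\ r <= s).
  have [_ _ [K [a H]]] := Ss; exists K, a; exact: expands_shrink H.
exfalso.
have Sr s : S s -> s < r by move=> Ss; rewrite ltNge; apply/negP => rs; apply: Hno; exists s.
set q := sup S.
have qr : q <= r by apply: ge_sup; [exists (Num.min 1 d1)|move=> s /Sr /ltW].
have Sq s : S s -> s <= q by move=> Ss; apply: ub_le_sup => //; case: hS.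
have q0 : 0 < q by have [h _ _] := S1; exact: lt_le_trans h (Sq _ S1).
have [K [d2 [d20 Hd]]] := uniform_expands (le_lt_trans qr r1) fan.
pose d := Num.min d2 (Num.min (q / 2) (1 - q)).
have d0 : 0 < d by rewrite !lt_min d20 divr_gt0 //= subr_gt0 (le_lt_trans qr).
have [dd2 dq d1q] : [/\ d <= d2, d <= q / 2 & d <= 1 - q].
  by rewrite /d !ge_min !lexx !orbT.
have [|s Ss sq] := @sup_adherent _ S (d / 8) _ hS; first by rewrite divr_gt0.
rewrite -/q in sq; have sq' := Sq _ Ss; have [s0 s1 [K0 [a Ha]]] := Ss.
have [||K' H'] := expands_extend d0 _ Ha (K := K); first by lra.
  move=> z zs; have [|b Hb] := Hd z; first by rewrite (le_trans (ltW zs)).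
  by exists b; exact: expands_shrink Hb.
suff /Sq : S (s + d / 4) by lra.
by split; [lra | lra | exists K', a].
Qed.

Lemma disk_expands f : analytic_on_disk f ->
  exists a, forall r, 0 < r -> r < 1 -> exists K, expands K r a f 0.
Proof.
move=> fan; have h0 : 0 < 2^-1 :> R by rewrite invr_gt0.
have [|K [a Ha]] := disk_expands_lt fan h0; first by lra.
exists a => r r0 r1; have [K' [b Hb]] := disk_expands_lt fan r0 r1.
by exists K'; rewrite (expands_unique h0 r0 ltr01 Ha Hb).
Qed.

End TaylorOnDisk.

(** * Linear changes of variables in the plane *)

Section PlanarIntegral.
Variable R : realType.
Implicit Types (z w : R[i]) (s t r : R) (h : R * R -> \bar R).

Local Notation leb := (@lebesgue_measure R).
Local Notation area := (leb \x leb)%E.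
Local Notation plane := (measurableTypeR R * measurableTypeR R)%type.

Lemma measurable_affine s t : measurable_fun [set: R] (fun x : R => s * x + t).
Proof. by apply: measurable_funD => //; exact: measurable_funM. Qed.

(** Both sides are integrals for the same measure: scaling the image of Lebesgue
measure under the affine map by [s] gives each interval its length. *)
Lemma integral_affine s t (g : R -> \bar R) : 0 < s ->
  measurable_fun [set: R] g -> (forall x, 0 <= g x)%E ->
  (s%:E * \int[leb]_x g (s * x + t)%R = \int[leb]_x g x)%E.
Proof.
move=> s0 mg g0.
pose phi : measurableTypeR R -> measurableTypeR R := fun x => s * x + t.
have mphi : measurable_fun [set: measurableTypeR R] phi := measurable_affine s t.
pose sn : {nonneg R} := NngNum (ltW s0).
pose push : {measure set (measurableTypeR R) -> \bar R} := pushforward leb phi.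
pose mu : {measure set (measurableTypeR R) -> \bar R} := mscale sn (push mphi).
have muE A : measurable A -> leb A = mu A.
  apply: lebesgue_measure_unique => _ [[a b]] _ <-.
  change (leb `]a, b]%classic = s%:E * leb (phi @^-1` `]a, b]%classic))%E.
  have -> : phi @^-1` `]a, b]%classic = `](a - t) / s, (b - t) / s]%classic.
    apply/seteqP; split => x /=; rewrite /phi !in_itv /= ltr_pdivrMr // ler_pdivlMr //;
    by rewrite ltrBlDr lerBrDr (mulrC x).
  rewrite !lebesgue_measure_itv /= !lte_fin ltr_pM2r ?invr_gt0 // ltrD2r.
  case: ifP => _; last by rewrite mule0.
  rewrite -!EFinB -EFinM -mulrBl mulrC divfK ?gt_eqF //.
  by congr _%:E; ring.
rewrite [RHS](@eq_measure_integral _ _ _ _ mu leb) => [|A mA _]; last exact: muE.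
rewrite ge0_integral_mscale //; congr (_ * _)%E.
by rewrite ge0_integral_pushforward // => x _; exact: g0.
Qed.

Lemma measurable_fst_section (g : plane -> \bar R) y :
  measurable_fun setT g -> measurable_fun [set: R] (fun x => g (x, y)).
Proof. by move=> mg; apply: measurableT_comp => //; exact: pair2_measurable. Qed.

Lemma measurable_snd_section (g : plane -> \bar R) x :
  measurable_fun setT g -> measurable_fun [set: R] (fun y => g (x, y)).
Proof. by move=> mg; apply: measurableT_comp => //; exact: pair1_measurable. Qed.

Lemma measurable_combination s t :
  measurable_fun [set: plane] (fun p : plane => s * p.1 + t * p.2).
Proof.
by apply: measurable_funD; apply: measurable_funM.
Qed.

Lemma measurable_fst_shear s t :
  measurable_fun [set: plane] (fun p : plane => (s * p.1 + t * p.2, p.2) : plane).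
Proof.
by apply: measurable_fun_pair; [exact: measurable_combination|exact: measurable_snd].
Qed.

Lemma measurable_snd_shear s t :
  measurable_fun [set: plane] (fun p : plane => (p.1, s * p.2 + t * p.1) : plane).
Proof.
apply: measurable_fun_pair; first exact: measurable_fst.
by under eq_fun do rewrite addrC; exact: measurable_combination.
Qed.

Lemma integral_fst_shear s t (g : plane -> \bar R) : 0 < s ->
  measurable_fun setT g -> (forall p, 0 <= g p)%E ->
  (s%:E * \int[area]_p g (s * p.1 + t * p.2, p.2)%R = \int[area]_p g p)%E.
Proof.
move=> s0 mg g0; pose g' p := g (s * p.1 + t * p.2, p.2).
have mg' : measurable_fun setT (g' : plane -> \bar R).
  exact: (measurableT_comp mg (measurable_fst_shear s t)).
have g'0 p : (0 <= g' p)%E by exact: g0.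
rewrite (fubini_tonelli2 (m1 := leb) (m2 := leb) g' mg' g'0).
rewrite (fubini_tonelli2 (m1 := leb) (m2 := leb) g mg g0).
rewrite -ge0_integralZl_EFin //; last 3 first.
- by move=> y _; apply: integral_ge0.
- exact: measurable_fun_fubini_tonelli_G.
- exact: ltW.
apply: eq_integral => y _; rewrite /fubini_G /g' /=.
exact: (integral_affine (t * y) s0 (measurable_fst_section y mg)).
Qed.

Lemma integral_snd_shear s t (g : plane -> \bar R) : 0 < s ->
  measurable_fun setT g -> (forall p, 0 <= g p)%E ->
  (s%:E * \int[area]_p g (p.1, s * p.2 + t * p.1)%R = \int[area]_p g p)%E.
Proof.
move=> s0 mg g0; pose g' p := g (p.1, s * p.2 + t * p.1).
have mg' : measurable_fun setT (g' : plane -> \bar R).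
  exact: (measurableT_comp mg (measurable_snd_shear s t)).
have g'0 p : (0 <= g' p)%E by exact: g0.
rewrite (fubini_tonelli1 (m1 := leb) (m2 := leb) g' mg' g'0).
rewrite (fubini_tonelli1 (m1 := leb) (m2 := leb) g mg g0).
rewrite -ge0_integralZl_EFin //; last 3 first.
- by move=> y _; apply: integral_ge0.
- exact: measurable_fun_fubini_tonelli_F.
- exact: ltW.
apply: eq_integral => x _; rewrite /fubini_F /g' /=.
exact: (integral_affine (t * x) s0 (measurable_snd_section x mg)).
Qed.

Lemma integral_dilation s (g : plane -> \bar R) : 0 < s ->
  measurable_fun setT g -> (forall p, 0 <= g p)%E ->
  ((s ^+ 2)%:E * \int[area]_p g (s * p.1, s * p.2)%R = \int[area]_p g p)%E.
Proof.
move=> s0 mg g0; rewrite -(integral_fst_shear 0 s0 mg g0).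
pose g' p := g (s * p.1 + 0 * p.2, p.2).
have mg' : measurable_fun setT (g' : plane -> \bar R).
  exact: (measurableT_comp mg (measurable_fst_shear s 0)).
rewrite -(integral_snd_shear 0 s0 mg' (fun p => g0 _)).
rewrite expr2 EFinM -muleA; congr (_ * (_ * _))%E.
by apply: eq_integral => p _; rewrite /g' /= !mul0r !addr0.
Qed.

Definition rotate z (p : plane) : plane :=
  let: x +i* y := z * (p.1 +i* p.2) in (x, y).

(** A rotation of angle [u] is the product of three shears, whose slopes are
[- tan (u / 2)], [sin u] and [- tan (u / 2)]; this fails for the half turn,
which is the square of a quarter turn. *)
Lemma integral_rotation z (g : plane -> \bar R) : normc z = 1 ->
  measurable_fun setT g -> (forall p, 0 <= g p)%E ->
  (\int[area]_p g (rotate z p) = \int[area]_p g p)%E.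
Proof.
have gen a b (k : plane -> \bar R) : b != 0 -> a ^+ 2 + b ^+ 2 = 1 ->
    measurable_fun setT k -> (forall p, 0 <= k p)%E ->
    (\int[area]_p k (a * p.1 - b * p.2, a * p.2 + b * p.1)%R = \int[area]_p k p)%E.
  move=> b0 ab mk k0; pose c := (a - 1) / b.
  pose k1 p := k (1 * p.1 + c * p.2, p.2).
  have mk1 : measurable_fun setT (k1 : plane -> \bar R).
    exact: (measurableT_comp mk (measurable_fst_shear 1 c)).
  pose k2 p := k1 (p.1, 1 * p.2 + b * p.1).
  have mk2 : measurable_fun setT (k2 : plane -> \bar R).
    exact: (measurableT_comp mk1 (measurable_snd_shear 1 b)).
  rewrite -(integral_fst_shear c ltr01 mk k0) mul1e -/k1.
  rewrite -(integral_snd_shear b ltr01 mk1 (fun p => k0 _)) mul1e -/k2.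
  rewrite -(integral_fst_shear c ltr01 mk2 (fun p => k0 _)) mul1e.
  apply: eq_integral => -[x y] _; rewrite /k2 /k1 /= !mul1r.
  have cb : c * b = a - 1 by rewrite /c divfK.
  have ca : c * (a + 1) = - b.
    apply: (mulIf b0); rewrite mulrAC cb mulNr -expr2.
    by rewrite -[b ^+ 2](addKr (a ^+ 2)) ab; ring.
  congr (k (_, _)).
    have -> : x + c * y + c * (y + b * (x + c * y)) =
      x + (c * b) * x + c * y + c * y + (c * b) * c * y by ring.
    by rewrite cb -(opprK b) -ca; ring.
  have -> : y + b * (x + c * y) = y + b * x + (c * b) * y by ring.
  by rewrite cb; ring.
move=> z1 mg g0; case: z z1 => a b z1.
have ab : a ^+ 2 + b ^+ 2 = 1 by have := sqr_normcE (a +i* b); rewrite z1 expr1n.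
have [b0|b0] := eqVneq b 0; last first.
  rewrite -(gen a b g b0 ab mg g0); apply: eq_integral => -[x y] _ /=.
  by rewrite (addrC (a * y)) (addrC (b * x)).
have /orP[/eqP a1|/eqP a1] : (a == 1) || (a == - 1).
- by rewrite -sqrf_eq1 -ab b0 expr0n addr0.
- apply: eq_integral => -[x y] _; rewrite /rotate /=.
  by rewrite a1 b0 !mul0r !mul1r subr0 addr0.
pose k1 p := g (0 * p.1 - 1 * p.2, 0 * p.2 + 1 * p.1).
have mk1 : measurable_fun setT (k1 : plane -> \bar R).
  apply: (measurableT_comp mg); apply: measurable_fun_pair.
    by under eq_fun do rewrite -mulNr; exact: measurable_combination.
  by under eq_fun do rewrite addrC; exact: measurable_combination.
have u1 : (0 : R) ^+ 2 + 1 ^+ 2 = 1 by rewrite expr0n expr1n add0r.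
rewrite -(gen 0 1 g (oner_neq0 _) u1 mg g0).
rewrite -(gen 0 1 k1 (oner_neq0 _) u1 mk1 (fun p => g0 _)).
apply: eq_integral => -[x y] _; rewrite /k1 /rotate /= a1 b0; congr (g (_, _)); ring.
Qed.

End PlanarIntegral.

(** * Integrals of squared moduli of polynomials *)

Section DiskIntegral.
Variable R : realType.
Implicit Types (a : nat -> R[i]) (f : R[i] -> R[i]) (z w : R[i]) (K s t r : R).

Local Notation leb := (@lebesgue_measure R).
Local Notation area := (leb \x leb)%E.
Local Notation plane := (measurableTypeR R * measurableTypeR R)%type.

Definition sqmod f (p : plane) : R := normc (f (p.1 +i* p.2)) ^+ 2.

Definition rdisk r : set plane := [set p | normc (p.1 +i* p.2) < r].

Definition mass f r : \bar R := (\int[area]_(p in rdisk r) (sqmod f p)%:E)%E.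

Lemma sqmod_ge0 f p : 0 <= sqmod f p.
Proof. by rewrite exprn_ge0 // normc_ge0. Qed.

Lemma mass_ge0 f r : (0 <= mass f r)%E.
Proof. by apply: integral_ge0 => p _; rewrite lee_fin sqmod_ge0. Qed.

Lemma measurable_psum a n :
  measurable_fun setT (fun p : plane => complex.Re (psum a n (p.1 +i* p.2))) /\
  measurable_fun setT (fun p : plane => complex.Im (psum a n (p.1 +i* p.2))).
Proof.
pose mc (F : plane -> R[i]) := measurable_fun setT (fun p => complex.Re (F p)) /\
                               measurable_fun setT (fun p => complex.Im (F p)).
have mcM F G : mc F -> mc G -> mc (fun p => F p * G p).
  move=> [F1 F2] [G1 G2]; split.
    rewrite (_ : (fun p => _) = (fun p => complex.Re (F p) * complex.Re (G p) -
      complex.Im (F p) * complex.Im (G p))).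
      by apply: measurable_funB; apply: measurable_funM.
    by apply/funext => p; case: (F p) (G p) => [x y] [u v].
  rewrite (_ : (fun p => _) = (fun p => complex.Re (F p) * complex.Im (G p) +
      complex.Im (F p) * complex.Re (G p))).
    by apply: measurable_funD; apply: measurable_funM.
  by apply/funext => p; case: (F p) (G p) => [x y] [u v].
have mcD F G : mc F -> mc G -> mc (fun p => F p + G p).
  move=> [F1 F2] [G1 G2]; split.
    rewrite (_ : (fun p => _) = (fun p => complex.Re (F p) + complex.Re (G p))).
      exact: measurable_funD.
    by apply/funext => p; case: (F p) (G p) => [x y] [u v].
  rewrite (_ : (fun p => _) = (fun p => complex.Im (F p) + complex.Im (G p))).
    exact: measurable_funD.
  by apply/funext => p; case: (F p) (G p) => [x y] [u v].
have mcC z : mc (fun=> z) by split; exact: measurable_cst.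
have mcX n0 : mc (fun p => (p.1 +i* p.2) ^+ n0).
  elim: n0 => [|m IH]; first exact: mcC.
  rewrite (_ : (fun p => _) = fun p : plane => (p.1 +i* p.2) * (p.1 +i* p.2) ^+ m).
    by apply: mcM => //; split; [exact: measurable_fst|exact: measurable_snd].
  by apply/funext => p; rewrite exprS.
suff : mc (fun p => psum a n (p.1 +i* p.2)) by [].
elim: n => [|n IH].
  rewrite (_ : (fun p => _) = fun=> 0); first exact: mcC.
  by apply/funext => p; rewrite /psum big_ord0.
rewrite (_ : (fun p => _) = fun p : plane => psum a n (p.1 +i* p.2) +
  a n * (p.1 +i* p.2) ^+ n).
  by apply: (mcD _ _ IH); apply: mcM.
by apply/funext => p; rewrite /psum big_ord_recr.
Qed.

Lemma measurable_sqmod_psum a n : measurable_fun setT (sqmod (psum a n)).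
Proof.
have [m1 m2] := measurable_psum a n.
rewrite (_ : sqmod _ = fun p : plane => complex.Re (psum a n (p.1 +i* p.2)) ^+ 2 +
  complex.Im (psum a n (p.1 +i* p.2)) ^+ 2); last first.
  by apply/funext => p; rewrite /sqmod sqr_normcE.
by apply: measurable_funD; apply: measurable_funX.
Qed.

Lemma sqmod_id (p : plane) : normc (p.1 +i* p.2) ^+ 2 = p.1 ^+ 2 + p.2 ^+ 2.
Proof. by rewrite sqr_normcE. Qed.

Lemma measurable_normc2 :
  measurable_fun setT (fun p : plane => normc (p.1 +i* p.2) ^+ 2).
Proof.
under eq_fun do rewrite sqmod_id.
by apply: measurable_funD; apply: measurable_funX; [exact: measurable_fst|exact: measurable_snd].
Qed.

Lemma measurable_rdisk r : measurable (rdisk r).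
Proof.
have [r0|r0] := ltP 0 r; last first.
  rewrite (_ : rdisk r = set0) //; apply/seteqP; split => // p /= pr.
  by have := le_lt_trans (normc_ge0 _) pr; rewrite ltNge r0.
rewrite (_ : rdisk r =
  setT `&` (fun p : plane => normc (p.1 +i* p.2) ^+ 2) @^-1` `]-oo, r ^+ 2[%classic).
  exact: measurable_normc2.
apply/seteqP; split => p /=; rewrite in_itv /=.
  by move=> pr; split => //; rewrite ltrXn2r ?normc_ge0.
by move=> [_]; rewrite ltr_pXn2r ?nnegrE ?normc_ge0 // ltW.
Qed.

Lemma area_rdisk_fin r : (area (rdisk r) < +oo)%E.
Proof.
apply: (@le_lt_trans _ _ (area (`[- r, r]%classic `*` `[- r, r]%classic))).
  apply: le_measure; rewrite ?inE; [exact: measurable_rdisk|exact: measurableX|].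
  move=> [x y] /= /ltW pr; rewrite !in_itv /= -!ler_norml.
  by rewrite (le_trans (normc_Re (x +i* y))) ?(le_trans (normc_Im (x +i* y))).
rewrite product_measure1E //= !lebesgue_measure_itv /=.
by case: ifP => _; rewrite ?mul0e // -EFinB -EFinM ltry.
Qed.

Lemma mass_fin f r (B : R) : measurable_fun (rdisk r) (sqmod f) ->
  (forall z, normc z < r -> normc (f z) <= B) -> (mass f r < +oo)%E.
Proof.
move=> mf fB.
apply: (@le_lt_trans _ _ (\int[area]_(p in rdisk r) (cst (B ^+ 2)%:E p))%E).
  apply: ge0_le_integral => //; first exact: measurable_rdisk.
  - by move=> p _; rewrite lee_fin sqmod_ge0.
  - exact/measurable_EFinP.
  move=> p pr; rewrite lee_fin /sqmod lerXn2r ?nnegrE ?normc_ge0 //; last exact: fB.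
  exact: le_trans (normc_ge0 _) (fB _ pr).
rewrite integral_cst; last exact: measurable_rdisk.
by rewrite lte_mul_pinfty ?lee_fin ?sqr_ge0 // area_rdisk_fin.
Qed.

Lemma mass_restrict f r : mass f r = (\int[area]_p ((EFin \o sqmod f) \_ (rdisk r)) p)%E.
Proof. exact: integral_mkcond. Qed.

Lemma measurable_restrict_sqmod f r : measurable_fun (rdisk r) (sqmod f) ->
  measurable_fun setT ((EFin \o sqmod f) \_ (rdisk r)).
Proof.
move=> mf; apply/(measurable_restrictT _ _).1; first exact: measurable_rdisk.
exact/measurable_EFinP.
Qed.

Lemma restrict_sqmod_ge0 f r p : (0 <= ((EFin \o sqmod f) \_ (rdisk r)) p)%E.
Proof. by apply: erestrict_ge0 => q _; rewrite lee_fin sqmod_ge0. Qed.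

Lemma mass_rotation f r z : normc z = 1 -> measurable_fun (rdisk r) (sqmod f) ->
  mass (fun w => f (z * w)) r = mass f r.
Proof.
move=> z1 mf; rewrite !mass_restrict.
rewrite -(integral_rotation z1 (measurable_restrict_sqmod mf)); last first.
  by move=> p; exact: restrict_sqmod_ge0.
apply: eq_integral => p _.
have rE : (rotate z p).1 +i* (rotate z p).2 = z * (p.1 +i* p.2).
  by rewrite /rotate; case: (z * _).
rewrite /patch /=; have -> : (rotate z p \in rdisk r) = (p \in rdisk r).
  by apply/idP/idP; rewrite !inE /rdisk /mkset rE Normc.normcM z1 mul1r.
by case: ifP => // _; rewrite /sqmod rE.
Qed.

Definition pow k z := z ^+ k.

Definition moment k : R := fine (mass (pow k) 1).

Lemma psum_delta k n z : (k < n)%N ->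
  psum (fun j => (j == k)%:R) n z = z ^+ k.
Proof.
move=> kn; rewrite /psum (bigD1 (Ordinal kn)) //= eqxx mul1r big1 ?addr0 //.
by move=> i ik; rewrite (negbTE (ik : (i != k :> nat))) mul0r.
Qed.

Lemma measurable_sqmod_power k : measurable_fun setT (sqmod (pow k)).
Proof.
rewrite (_ : pow k = psum (fun j => (j == k)%:R) k.+1).
  exact: measurable_sqmod_psum.
by apply/funext => z; rewrite psum_delta.
Qed.

Lemma moment_ge0 k : 0 <= moment k.
Proof. by rewrite fine_ge0 // mass_ge0. Qed.

Lemma mass_power k r : 0 < r ->
  mass (pow k) r = (moment k * r ^+ (2 * k.+1))%:E.
Proof.
move=> r0; have mk := measurable_sqmod_power k.
have mkr s : measurable_fun (rdisk s) (sqmod (pow k)).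
  exact: (measurable_funS measurableT _ mk).
have -> : (moment k * r ^+ (2 * k.+1))%:E =
    ((r ^+ (2 * k.+1))%:E * mass (pow k) 1)%E.
  rewrite mulrC EFinM fineK // ge0_fin_numE ?mass_ge0 //.
  apply: (mass_fin (B := 1)) => // z /ltW z1.
  by rewrite /pow normcX exprn_ile1 ?normc_ge0.
rewrite !mass_restrict -(integral_dilation r0 (measurable_restrict_sqmod (mkr r))); last first.
  by move=> p; exact: restrict_sqmod_ge0.
rewrite mulnS exprD (EFinM (r ^+ 2)) -muleA; congr (_ * _)%E.
rewrite -ge0_integralZl_EFin ?exprn_ge0 ?(ltW r0) //; last 2 first.
- by move=> p _; exact: restrict_sqmod_ge0.
- exact: measurable_restrict_sqmod.
apply: eq_integral => p _; rewrite /patch /=.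
have rE : (r * p.1) +i* (r * p.2) = r%:C * (p.1 +i* p.2).
  by apply/eqP; rewrite eq_complex /= !mul0r subr0 addr0 !eqxx.
have rN : normc ((r * p.1) +i* (r * p.2)) = r * normc (p.1 +i* p.2).
  by rewrite rE Normc.normcM normc_real gtr0_norm.
have -> : (((r * p.1, r * p.2) : plane) \in rdisk r) = (p \in rdisk 1).
  by apply/idP/idP; rewrite !inE /rdisk /mkset rN -{2}[r]mulr1 ltr_pM2l.
case: ifP => _; last by rewrite mule0.
rewrite -EFinM /sqmod /pow !normcX.
by rewrite -[normc ((_, _).1 +i* _)]/(normc ((r * p.1) +i* (r * p.2))) rN exprMn exprMn -exprM (mulnC 2%N).
Qed.

(** Averaging over the [n]-th roots of unity, all of which give the same
integral, leaves only the diagonal terms of [normc (psum a n z) ^+ 2]. *)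
Lemma mass_psum a n r : 0 < r ->
  mass (psum a n) r =
  (\sum_(k < n) normc (a k) ^+ 2 * moment k * r ^+ (2 * k.+1))%:E.
Proof.
move=> r0; case: n => [|n].
  rewrite big_ord0 /mass integral0_eq // => p _.
  by rewrite /sqmod /psum big_ord0 Normc.normc0 expr0n.
set N := n.+1; have N0 : N%:R != 0 :> R by rewrite pnatr_eq0.
have [x px] := @prim_root_ex R _ (ltn0Sn n).
have mpN s b : measurable_fun (rdisk s) (sqmod (psum b N)).
  exact: (measurable_funS measurableT _ (measurable_sqmod_psum b N)).
have xj j : normc (x ^+ j) = 1.
  by rewrite normcX (normc_prim_root (ltn0Sn n) px) expr1n.
pose b j k := a k * (x ^+ j) ^+ k.
have bE j : (fun w => psum a N (x ^+ j * w)) = psum (b j) N.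
  apply/funext => w; apply: eq_bigr => k _.
  by rewrite exprMn mulrA.
have finN : mass (psum a N) r \is a fin_num.
  rewrite ge0_fin_numE ?mass_ge0 //.
  apply: (@mass_fin _ _ (\sum_(k < N) normc (a k) * r ^+ k)) => // z /ltW zr.
  rewrite (le_trans (normc_sum _ _ _)) // ler_sum // => k _.
  rewrite Normc.normcM normcX ler_wpM2l ?normc_ge0 // lerXn2r ?nnegrE ?normc_ge0 //.
  exact: ltW.
have key : (\int[area]_(p in rdisk r) (\sum_(j < N) (sqmod (psum (b j) N) p)%:E) =
    \int[area]_(p in rdisk r) (\sum_(k < N)
      (N%:R * normc (a k) ^+ 2)%:E * (sqmod (pow k) p)%:E))%E.
  apply: eq_integral => p _; rewrite sumEFin.
  rewrite (eq_bigr (fun k : 'I_N => (N%:R * (normc (a k) ^+ 2 *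
     normc (p.1 +i* p.2) ^+ (2 * k)))%:E)); last first.
    by move=> k _; rewrite -EFinM /sqmod /pow normcX -exprM (mulnC 2%N) mulrA.
  rewrite sumEFin -mulr_sumr -(discrete_parseval _ _ px); congr _%:E.
  by apply: eq_bigr => j _; rewrite /sqmod -bE.
move: key; rewrite ge0_integral_sum //=; last 3 first.
- exact: measurable_rdisk.
- by move=> j; exact/measurable_EFinP.
- by move=> j p _; rewrite lee_fin sqmod_ge0.
rewrite (eq_bigr (fun=> mass (psum a N) r)); last first.
  by move=> j _; rewrite -(mass_rotation (xj j) (mpN r a)) bE.
rewrite -(fineK finN) sumEFin sumr_const card_ord.
have mpow k : measurable_fun (rdisk r) (fun p => (sqmod (pow k) p)%:E).
  apply/measurable_EFinP.
  exact: (measurable_funS measurableT _ (measurable_sqmod_power k)).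
rewrite ge0_integral_sum //=; last 3 first.
- exact: measurable_rdisk.
- by move=> k; apply: measurable_funeM.
- by move=> k p _; rewrite -EFinM lee_fin !mulr_ge0 ?exprn_ge0 ?normc_ge0.
rewrite (eq_bigr (fun k : 'I_N => (N%:R * (normc (a k) ^+ 2 * moment k * r ^+ (2 * k.+1)))%:E)).
  by rewrite sumEFin -mulr_sumr -[_ *+ N]mulr_natl => -[]; move/(mulfI N0) => ->.
move=> k _; rewrite ge0_integralZl_EFin //; last 3 first.
- exact: measurable_rdisk.
- by move=> p _; rewrite lee_fin sqmod_ge0.
- by rewrite mulr_ge0 ?sqr_ge0.
by rewrite -/(mass _ r) mass_power // -EFinM !mulrA.
Qed.

End DiskIntegral.

(** * Integrals of squared moduli of analytic functions *)

Section AnalyticMass.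
Variable R : realType.
Implicit Types (a : nat -> R[i]) (f g : R[i] -> R[i]) (z w : R[i]) (K c s t r : R).

Local Notation leb := (@lebesgue_measure R).
Local Notation area := (leb \x leb)%E.
Local Notation plane := (measurableTypeR R * measurableTypeR R)%type.

Lemma cvg_sqmod_psum K s a f (p : plane) : 0 < s -> expands K s a f 0 ->
  rdisk s p -> (fun n => sqmod (psum a n) p) @ \oo --> sqmod f p.
Proof.
move=> s0 [_ Hf] ps; rewrite /sqmod; set z := p.1 +i* p.2 in ps *.
have zs : normc (z - 0) < s by rewrite subr0.
suff H : (fun n => normc (psum a n z)) @ \oo --> normc (f z).
  under eq_fun do rewrite expr2; rewrite expr2; exact: cvgM.
have t0 : 0 <= normc z / s by rewrite divr_ge0 ?normc_ge0 // ltW.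
have t1 : normc z / s < 1 by rewrite ltr_pdivrMr // mul1r.
have T0 := tail_cvg K t0 t1.
apply/cvgrPdist_le => e e0.
move/cvgrPdist_le: T0 => /(_ e e0)[N _ HN]; exists N => // n /HN /=.
rewrite sub0r normrN => /(le_trans (ler_norm _)) H.
apply: le_trans H; have := Hf z zs n; rewrite subr0.
apply: le_trans; rewrite ler_norml lerBlDr; apply/andP; split.
  rewrite lerNl opprB lerBlDr normc_distC.
  by rewrite (le_trans _ (normcD _ _)) // subrK.
by rewrite (le_trans _ (normcD _ _)) // subrK.
Qed.

Lemma mass_cvg K s a f r : 0 < r -> r < s -> expands K s a f 0 ->
  (mass f r < +oo)%E /\
  (fun n => mass (psum a n) r) @ \oo --> mass f r.
Proof.
move=> r0 rs Ha; have s0 := lt_trans r0 rs; have [aK Hf] := Ha.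
have K0 := coef_bound_ge0 aK.
pose B := K / (1 - r / s).
have rs1 : r / s < 1 by rewrite ltr_pdivrMr // mul1r.
have zB z : normc z < r -> tail K (normc z / s) 0 <= B.
  move=> zr; rewrite /tail mulr1 ler_wpM2l // lef_pV2 ?posrE ?subr_gt0 //.
    by rewrite lerD2l lerN2 ler_wpM2r ?invr_ge0 ?(ltW s0) ?(ltW zr).
  by rewrite ltr_pdivrMr // mul1r (lt_trans zr).
have pB n z : normc z < r -> normc (psum a n z) <= B.
  move=> zr; have := psum_tail s0 aK (lt_trans zr rs) (leq0n n).
  rewrite {2}/psum big_ord0 subr0 => H; exact: le_trans H (zB _ zr).
have sub : rdisk r `<=` rdisk s by move=> p /lt_trans; apply.
have cvp p : rdisk r p -> (fun n => sqmod (psum a n) p) @ \oo --> sqmod f p.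
  by move=> /sub; exact: cvg_sqmod_psum Ha.
have mp n : measurable_fun (rdisk r) (sqmod (psum a n)).
  exact: (measurable_funS measurableT _ (measurable_sqmod_psum a n)).
have mf : measurable_fun (rdisk r) (sqmod f) by exact: (measurable_fun_cvg mp cvp).
split.
  apply: (mass_fin (B := B) mf) => z zr; apply: le_trans (zB _ zr).
  have := Hf z; rewrite subr0 => /(_ (lt_trans zr rs) 0%N).
  by rewrite /psum big_ord0 subr0.
have B0 : 0 <= B by rewrite divr_ge0 // subr_ge0 ltW.
have [|||||_ _] := @dominated_convergence _ _ _ area (rdisk r) (measurable_rdisk r)
  (fun n p => (sqmod (psum a n) p)%:E) (EFin \o sqmod f) (EFin \o cst (B ^+ 2)).
- by move=> n; exact/measurable_EFinP.
- exact/measurable_EFinP.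
- apply/aeW => p pr /=; apply: cvg_EFin; last exact: cvp.
  by apply: nearW.
- apply: measurable_bounded_integrable => //; first exact: measurable_rdisk.
    exact: area_rdisk_fin.
  by exists (B ^+ 2); split; [exact: num_real|move=> x xB p _ /=; rewrite ger0_norm ?sqr_ge0 // ltW].
- apply/aeW => p pr n /=; rewrite lee_fin ger0_norm ?sqmod_ge0 //.
  rewrite /sqmod lerXn2r ?nnegrE ?normc_ge0 //; exact: pB.
by [].
Qed.

Lemma measurable_sqmod_disk f : analytic_on_disk f ->
  measurable_fun (rdisk 1) (sqmod f).
Proof.
move=> /disk_expands [a Ha].
apply: (measurable_fun_cvg (h := fun n => sqmod (psum a n))) => [n|p p1].
  exact: (measurable_funS measurableT _ (measurable_sqmod_psum a n)).
pose s := (normc (p.1 +i* p.2) + 1) / 2.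
have p0 := normc_ge0 (p.1 +i* p.2); move: p1; rewrite /rdisk /mkset => p1.
have [||K HK] := Ha s; rewrite /s; [lra|lra|].
apply: (cvg_sqmod_psum _ HK); rewrite ?/rdisk /mkset /s; lra.
Qed.

(** The form in which analyticity gives inequalities: two masses are compared
by comparing nonnegative power series in [r ^+ 2] term by term. *)
Lemma mass_series f : analytic_on_disk f -> exists y : nat -> R,
  (forall k, 0 <= y k) /\ forall r, 0 < r -> r < 1 ->
    mass f r \is a fin_num /\
    (fun n => \sum_(k < n) y k * (r ^+ 2) ^+ k.+1) @ \oo --> fine (mass f r).
Proof.
move=> /disk_expands [a Ha].
exists (fun k => normc (a k) ^+ 2 * moment R k); split => [k|r r0 r1].
  by rewrite mulr_ge0 ?sqr_ge0 ?moment_ge0.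
pose s := (r + 1) / 2.
have [||K HK] := Ha s; rewrite /s; [lra|lra|].
have rs : r < s by rewrite /s; lra.
have [fin cv] := mass_cvg r0 rs HK.
have fn : mass f r \is a fin_num by rewrite ge0_fin_numE ?mass_ge0.
split=> //; rewrite -(fineK fn) in cv.
move/fine_cvg: cv; apply: cvg_trans; apply: near_eq_cvg; apply: nearW => n.
by rewrite /= mass_psum //=; apply: eq_bigr => k _; rewrite exprM.
Qed.

Lemma ler_lim_sum (u v w : nat -> R) (x y q lam mu : R) :
  (forall n, lam * u n <= v n + mu * w n) ->
  u @ \oo --> x -> v @ \oo --> y -> w @ \oo --> q -> lam * x <= y + mu * q.
Proof.
move=> H ux vy wz.
have c1 : (fun n => lam * u n) @ \oo --> lam * x by exact: cvgMl_tmp.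
have c2 : (fun n => v n + mu * w n) @ \oo --> y + mu * q.
  by apply: cvgD => //; exact: cvgMl_tmp.
by apply: (ler_cvg_to c1 c2); exact: nearW.
Qed.

(** The mass as a real number; the default value 0 of [fine] at infinity does not
occur for functions of the Bergman space and radii at most 1. *)
Definition rmass f r : R := fine (mass f r).

(** Termwise, [(t ^+ 2) ^+ k.+1 <= t ^+ 2]. *)
Lemma rmass_contract f r t : analytic_on_disk f -> 0 < r -> r < 1 ->
  0 < t -> t <= 1 -> rmass f (t * r) <= t ^+ 2 * rmass f r.
Proof.
move=> /mass_series [y [y0 H]] r0 r1 t0 t1.
have tr0 : 0 < t * r by rewrite mulr_gt0.
have tr1 : t * r < 1 by rewrite (le_lt_trans _ r1) // ler_piMl // ltW.
have [_ c1] := H _ tr0 tr1; have [_ c2] := H _ r0 r1.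
rewrite -[leLHS]mul1r -[leRHS]add0r.
apply: (ler_lim_sum _ c1 (cvg_cst 0) c2) => n.
rewrite mul1r add0r mulr_sumr; apply: ler_sum => k _.
rewrite (exprMn 2) (exprMn k.+1) mulrCA ler_wpM2r ?mulr_ge0 ?exprn_ge0 ?(ltW r0) //.
by rewrite exprS ler_piMr ?sqr_ge0 // exprn_ile1 ?sqr_ge0 // exprn_ile1 // ltW.
Qed.

(** A three circles inequality.  It is the logarithmic convexity
[rmass f (t * r) ^+ 2 <= rmass f (t ^+ 2 * r) * rmass f r] with a free parameter
[lam] in place of the optimal one, because in this linear form it holds term by
term, by [0 <= ((t ^+ 2) ^+ k.+1 - lam) ^+ 2]. *)
Lemma rmass_three_circles f r t lam : analytic_on_disk f -> 0 < r -> r < 1 ->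
  0 < t -> t <= 1 ->
  2 * lam * rmass f (t * r) <= rmass f (t ^+ 2 * r) + lam ^+ 2 * rmass f r.
Proof.
move=> /mass_series [y [y0 H]] r0 r1 t0 t1.
have lt1 u : 0 < u -> u <= 1 -> 0 < u * r /\ u * r < 1.
  by move=> u0 u1; rewrite mulr_gt0 //; split => //; rewrite (le_lt_trans _ r1) // ler_piMl // ltW.
have [tr0 tr1] := lt1 _ t0 t1.
have [ttr0 ttr1] : 0 < t ^+ 2 * r /\ t ^+ 2 * r < 1.
  by apply: lt1; rewrite ?exprn_gt0 // exprn_ile1 // ltW.
have [_ c1] := H _ tr0 tr1; have [_ c2] := H _ r0 r1; have [_ c3] := H _ ttr0 ttr1.
apply: (ler_lim_sum _ c1 c3 c2) => n.
rewrite !mulr_sumr -big_split; apply: ler_sum => k _ /=.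
rewrite (exprMn 2 (t ^+ 2) r) (exprMn 2 t r).
rewrite (exprMn k.+1 ((t ^+ 2) ^+ 2)) (exprMn k.+1 (t ^+ 2)).
set T := (t ^+ 2) ^+ k.+1; have -> : ((t ^+ 2) ^+ 2) ^+ k.+1 = T ^+ 2.
  by rewrite /T -exprM mulnC exprM.
have h : 0 <= (y k * (r ^+ 2) ^+ k.+1) * (T - lam) ^+ 2.
  apply: mulr_ge0; last exact: sqr_ge0.
  by apply: mulr_ge0 => //; apply: exprn_ge0; exact: sqr_ge0.
by rewrite -subr_ge0 (le_trans h) // le_eqVlt; apply/orP; left; apply/eqP; ring.
Qed.

Definition rannulus c r : set plane := rdisk r `\` rdisk c.

Definition ring_mass f c r : \bar R :=
  (\int[area]_(p in rannulus c r) (sqmod f p)%:E)%E.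

Lemma measurable_rannulus c r : measurable (rannulus c r).
Proof. by apply: measurableD; exact: measurable_rdisk. Qed.

Lemma ring_mass_ge0 f c r : (0 <= ring_mass f c r)%E.
Proof. by apply: integral_ge0 => p _; rewrite lee_fin sqmod_ge0. Qed.

Lemma mass_split f c r : analytic_on_disk f -> c <= r -> r <= 1 ->
  mass f r = (mass f c + ring_mass f c r)%E.
Proof.
move=> fan cr r1.
have sub : rdisk c `<=` rdisk r by move=> p /lt_le_trans; apply.
have sub1 : rdisk r `<=` rdisk 1 by move=> p /lt_le_trans; apply.
have E : rdisk c `|` rannulus c r = rdisk r by rewrite /rannulus setDUK.
rewrite /mass -{1}E ge0_integral_setU //.
- exact: measurable_rdisk.
- exact: measurable_rannulus.
- rewrite E; apply/measurable_EFinP.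
  exact: (measurable_funS (measurable_rdisk 1) sub1 (measurable_sqmod_disk fan)).
- by move=> p _; rewrite lee_fin sqmod_ge0.
- by apply/disj_setPS => p [/= pc [_]].
Qed.

Lemma ring_mass_le f g c r (M : R) : analytic_on_disk f -> analytic_on_disk g ->
  r <= 1 -> 0 <= M ->
  (forall z, annulus c z -> normc (f z) <= M * normc (g z)) ->
  (ring_mass f c r <= (M ^+ 2)%:E * ring_mass g c r)%E.
Proof.
move=> fan gan r1 M0 fg.
have sub1 : rannulus c r `<=` rdisk 1 by move=> p [/lt_le_trans pr _]; exact: pr.
have mr h : analytic_on_disk h -> measurable_fun (rannulus c r) (EFin \o sqmod h).
  move=> han; apply/measurable_EFinP.
  exact: (measurable_funS (measurable_rdisk 1) sub1 (measurable_sqmod_disk han)).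
rewrite /ring_mass -ge0_integralZl_EFin ?sqr_ge0 //; last 3 first.
- exact: measurable_rannulus.
- by move=> p _; rewrite lee_fin sqmod_ge0.
- exact: mr.
apply: ge0_le_integral => //.
- exact: measurable_rannulus.
- by move=> p _; rewrite lee_fin sqmod_ge0.
- exact: mr.
- by apply: measurable_funeM; exact: mr.
move=> p [pr pc]; rewrite -EFinM lee_fin /sqmod -exprMn.
rewrite lerXn2r ?nnegrE ?mulr_ge0 ?normc_ge0 // fg //; apply/andP; split.
  by rewrite leNgt; apply/negP.
exact: lt_le_trans pr r1.
Qed.

End AnalyticMass.

(** * The two bounds *)

Section BergmanRatio.
Variable R : realType.
Implicit Types (f g : R[i] -> R[i]) (z : R[i]) (c r M P : R).

Lemma bergman_norm_sqr f : (bergman_norm f ^+ 2 = (pi^-1)%:E * mass f 1)%E.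
Proof.
have h : (0 <= (pi^-1)%:E * mass f 1)%E.
  by rewrite mule_ge0 ?mass_ge0 // lee_fin invr_ge0 pi_ge0.
by rewrite /bergman_norm poweR12_sqrt // sqr_sqrte.
Qed.

Lemma bergman_mass1_fin f : bergman f -> mass f 1 \is a fin_num.
Proof.
move=> [_ ffin]; rewrite ge0_fin_numE ?mass_ge0 // ltey; apply/eqP => moo.
move: ffin; rewrite /bergman_norm -[X in (_ * X)%E]/(mass f 1) moo.
by rewrite gt0_muley ?lte_fin ?invr_gt0 ?pi_gt0 // poweRyr ?invr_eq0.
Qed.

Definition rring_mass f c r : R := fine (ring_mass f c r).

Lemma rmass_ge0 f r : 0 <= rmass f r.
Proof. by rewrite fine_ge0 // mass_ge0. Qed.

Lemma rring_mass_ge0 f c r : 0 <= rring_mass f c r.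
Proof. by rewrite fine_ge0 // ring_mass_ge0. Qed.

Lemma bergman_fin f c r : bergman f -> c <= r -> r <= 1 ->
  [/\ mass f r \is a fin_num, mass f c \is a fin_num & ring_mass f c r \is a fin_num].
Proof.
move=> fb cr r1; have [fan _] := fb.
have fr : mass f r \is a fin_num.
  have := bergman_mass1_fin fb; rewrite (mass_split fan r1 (lexx 1)).
  by rewrite fin_numD => /andP[].
split=> //; move: fr; rewrite (mass_split fan cr r1) fin_numD => /andP[] //.
Qed.

Lemma rmass_split f c r : bergman f -> c <= r -> r <= 1 ->
  rmass f r = rmass f c + rring_mass f c r.
Proof.
move=> fb cr r1; have [_ fc fr] := bergman_fin fb cr r1; have [fan _] := fb.
by rewrite /rmass (mass_split fan cr r1) fineD.
Qed.

Lemma rring_mass_le f g c r M : bergman f -> bergman g -> c <= r -> r <= 1 -> 0 <= M ->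
  (forall z, annulus c z -> normc (f z) <= M * normc (g z)) ->
  rring_mass f c r <= M ^+ 2 * rring_mass g c r.
Proof.
move=> fb gb cr r1 M0 fg.
have [_ _ ff] := bergman_fin fb cr r1; have [_ _ gf] := bergman_fin gb cr r1.
have [fan _] := fb; have [gan _] := gb.
have := ring_mass_le fan gan r1 M0 fg.
by rewrite -(fineK ff) -(fineK gf) -EFinM lee_fin.
Qed.

Lemma rmass_mono f c r : bergman f -> c <= r -> r <= 1 -> rmass f c <= rmass f r.
Proof. by move=> fb cr r1; rewrite (rmass_split fb cr r1) lerDl rring_mass_ge0. Qed.

(** The series is available for radii less than 1 only; a radius close to 1 is
enough, as the mass increases with the radius. *)
Lemma rmass_contract1 f c : bergman f -> 0 < c -> c < 1 ->
  rmass f c <= c ^+ 2 * rmass f 1.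
Proof.
move=> fb c0 c1; have [fan _] := fb.
rewrite leNgt; apply/negP => H.
have I0 : 0 < rmass f c.
  by apply: le_lt_trans H; rewrite mulr_ge0 ?sqr_ge0 ?rmass_ge0.
pose x := c ^+ 2 * rmass f 1 / rmass f c.
have x0 : 0 <= x by apply: divr_ge0; rewrite ?rmass_ge0 // mulr_ge0 ?sqr_ge0 ?rmass_ge0.
have x1 : x < 1 by rewrite ltr_pdivrMr // mul1r.
pose r := Num.max c ((1 + x) / 2).
have [cr xr] : c <= r /\ (1 + x) / 2 <= r by rewrite /r !le_max !lexx orbT.
have r1 : r < 1 by rewrite gt_max c1 /=; lra.
have r0 : 0 < r := lt_le_trans c0 cr.
have cr1 : c / r <= 1 by rewrite ler_pdivrMr // mul1r.
have := rmass_contract fan r0 r1 (divr_gt0 c0 r0) cr1.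
rewrite divfK ?gt_eqF // leNgt => /negP; apply.
apply: (@le_lt_trans _ _ ((c / r) ^+ 2 * rmass f 1)).
  by rewrite ler_wpM2l ?sqr_ge0 // rmass_mono // ltW.
rewrite expr_div_n mulrAC ltr_pdivrMr ?exprn_gt0 //.
rewrite [ltRHS]mulrC -ltr_pdivrMr // -/x.
have h : ((1 + x) / 2) ^+ 2 <= r ^+ 2.
  by rewrite lerXn2r ?nnegrE //; lra.
apply: lt_le_trans h; nra.
Qed.

(** The annulus contributes nothing positive to the difference of the squared norms,
and contraction bounds the contribution of the disk of radius [c]. *)
Lemma F_B_le c : 0 < c -> c < 1 -> (F_B c <= (c ^+ 2)%:E)%E.
Proof.
move=> c0 c1; apply: ge_ereal_sup => _ [[f g] [/= fb gb f1 g1 fg] <-].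
have p0 : 0 < pi^-1 :> R by rewrite invr_gt0 pi_gt0.
have ff := bergman_mass1_fin fb; have gf := bergman_mass1_fin gb.
have If1 : pi^-1 * rmass f 1 <= 1.
  rewrite -lee_fin EFinM fineK // -bergman_norm_sqr -(expr1n _ 2) EFin_expe.
  by rewrite lee_sqr ?poweR_ge0.
rewrite -!expe2 !bergman_norm_sqr -(fineK ff) -(fineK gf) -!EFinM -EFinB lee_fin.
rewrite -/(rmass f 1) -/(rmass g 1).
have fg' z : annulus c z -> normc (f z) <= 1 * normc (g z) by rewrite mul1r; exact: fg.
have h1 := rring_mass_le fb gb (ltW c1) (lexx 1) ler01 fg'.
have h2 := rmass_split fb (ltW c1) (lexx 1).
have h3 := rmass_split gb (ltW c1) (lexx 1).
have h4 := rmass_contract1 fb c0 c1; have h5 := rmass_ge0 g c.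
rewrite expr1n mul1r in h1.
rewrite -mulrBr.
apply: (@le_trans _ _ (pi^-1 * (c ^+ 2 * rmass f 1))).
  by rewrite ler_pM2l //; lra.
by rewrite mulrCA ler_piMr ?sqr_ge0.
Qed.

(** Its square is the share of the mass of [g] inside radius [c] that separates the
two cases below.  With [t = (1 + c) / 2] it solves
[t / (1 - t) * small_mass c = c ^+ 2]. *)
Definition small_mass c : R := c ^+ 2 * (1 - (1 + c) / 2) / ((1 + c) / 2).

(** The crude bound [1 - c ^+ 2 <= M ^+ 2] is improved in one of two ways.  If [g]
has a share of its mass in the disk of radius [c], its annulus has less of it.
If not, the three circles inequality makes [g] small up to a radius [q > c],
hence also [f] between [c] and [q]; by contraction the share of [f] inside [c]
is then at most [M ^+ 2 * c ^+ 2] instead of [c ^+ 2]. *)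
Lemma ratio_dichotomy f g c M P : bergman f -> bergman g -> 0 < c -> c < 1 ->
  0 < P -> rmass f 1 = P -> rmass g 1 = P -> 0 <= M ->
  (forall z, annulus c z -> normc (f z) <= M * normc (g z)) ->
  1 - c ^+ 2 <= M ^+ 2 * (1 - small_mass c ^+ 2) \/ 1 <= M ^+ 2 * (1 + c ^+ 2).
Proof.
move=> fb gb c0 c1 P0 fP gP M0 fg; have [fan _] := fb; have [gan _] := gb.
pose t := (1 + c) / 2; pose l := small_mass c.
have [t0 t1 ct] : [/\ 0 < t, t < 1 & c < t] by rewrite /t; split; lra.
have lE : l * t = c ^+ 2 * (1 - t) by rewrite /l /small_mass -/t divfK ?gt_eqF.
have l0 : 0 < l by rewrite /l /small_mass -/t divr_gt0 // mulr_gt0 ?exprn_gt0 ?subr_gt0.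
have Q0 : 0 <= M ^+ 2 by exact: sqr_ge0.
have eP : rring_mass f c 1 <= M ^+ 2 * rring_mass g c 1.
  exact: (rring_mass_le fb gb (ltW c1) (lexx 1) M0 fg).
have f1 := rmass_split fb (ltW c1) (lexx 1).
have g1 := rmass_split gb (ltW c1) (lexx 1).
rewrite fP in f1; rewrite gP in g1.
have fc := rmass_contract1 fb c0 c1; rewrite fP in fc.
have [dl|dl] := ltP (l ^+ 2 * P) (rmass g c).
  left; rewrite -/l -(ler_pM2r P0).
  have rg : rring_mass g c 1 = P - rmass g c by lra.
  rewrite rg in eP.
  have h : M ^+ 2 * (P - rmass g c) <= M ^+ 2 * (P - l ^+ 2 * P).
    by rewrite ler_wpM2l // lerD2l lerN2 ltW.
  have -> : M ^+ 2 * (1 - l ^+ 2) * P = M ^+ 2 * (P - l ^+ 2 * P) by ring.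
  lra.
right; rewrite -(ler_pM2r P0).
pose s := Num.sqrt t.
have s0 : 0 < s by rewrite sqrtr_gt0.
have ss : s ^+ 2 = t by rewrite sqr_sqrtr // ltW.
have s1 : s < 1 by rewrite -sqrtr1 ltr_sqrt.
(* The three radii are [c = s ^+ 2 * r], [q = s * r] and [r]. *)
pose r := c / t; pose q := c / s.
have [r0 r1] : 0 < r /\ r < 1 by rewrite divr_gt0 // ltr_pdivrMr // mul1r.
have sr : s * r = q.
  by rewrite /r /q -ss expr2 invfM mulrCA mulrA mulrA mulfK // gt_eqF.
have tr : s ^+ 2 * r = c by rewrite ss /r mulrC divfK // gt_eqF.
have sq : s * q = c by rewrite /q mulrC divfK // gt_eqF.
have q0 : 0 < q by rewrite divr_gt0.
have cq : c <= q by rewrite -sq ler_piMl // ltW.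
have q1 : q < 1 by rewrite -sr (le_lt_trans _ r1) // ler_piMl // ltW.
have three := rmass_three_circles l gan r0 r1 s0 (ltW s1).
rewrite sr tr in three.
have gr := rmass_mono gb (ltW r1) (lexx 1); rewrite gP in gr.
have gq : rmass g q <= l * P.
  have h : l ^+ 2 * rmass g r <= l ^+ 2 * P by rewrite ler_wpM2l ?sqr_ge0.
  rewrite -(ler_pM2l l0) mulrA -expr2; lra.
have fq := rmass_contract fan q0 q1 s0 (ltW s1); rewrite sq ss in fq.
have fs := rmass_split fb cq (ltW q1); have gs := rmass_split gb cq (ltW q1).
have eq' := rring_mass_le fb gb cq (ltW q1) M0 fg.
have gc0 := rmass_ge0 g c.
have h1 : M ^+ 2 * rring_mass g c q <= M ^+ 2 * (l * P) by rewrite ler_wpM2l //; lra.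
have h2 : (1 - t) * rmass f q <= M ^+ 2 * (l * P) by lra.
have h3 : rmass f c <= M ^+ 2 * c ^+ 2 * P.
  have t1' : 0 < 1 - t by rewrite subr_gt0.
  rewrite -(ler_pM2l t1').
  have -> : (1 - t) * (M ^+ 2 * c ^+ 2 * P) = t * (M ^+ 2 * (l * P)).
    have -> : t * (M ^+ 2 * (l * P)) = M ^+ 2 * (l * t) * P by ring.
    by rewrite lE; ring.
  have : t * ((1 - t) * rmass f q) <= t * (M ^+ 2 * (l * P)) by rewrite ler_pM2l.
  have : (1 - t) * rmass f c <= (1 - t) * (t * rmass f q) by rewrite ler_pM2l.
  lra.
have h4 : M ^+ 2 * rring_mass g c 1 <= M ^+ 2 * P by rewrite ler_wpM2l //; lra.
have -> : M ^+ 2 * (1 + c ^+ 2) * P = M ^+ 2 * P + M ^+ 2 * c ^+ 2 * P by ring.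
lra.
Qed.

(** Away from common zeros the quotient is computed by the factorization with
exponent 0, and a zero of [g] alone would make it infinite. *)
Lemma sup_quotient_dominates c f g M : analytic_on_disk f -> analytic_on_disk g ->
  0 <= M -> (sup_quotient c f g < M%:E)%E ->
  forall z, annulus c z -> normc (f z) <= M * normc (g z).
Proof.
move=> fan gan M0 sM z zc.
have [/andP[/eqP f0 /eqP g0]|nz] := boolP ((f z == 0) && (g z == 0)).
  by rewrite f0 Normc.normc0 mulr_ge0 ?normc_ge0.
have zd : disk z by case/andP: zc.
pose q : \bar R := if g z == 0 then +oo%E else (normc (f z / g z))%:E.
have : (q < M%:E)%E.
  apply: le_lt_trans sM; apply: ereal_sup_ubound; exists z => //.
  exists 0%N, f, g; split=> //; [exact: fan|exact: gan|by rewrite -negb_and|].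
  by apply/nearcP; exists 1 => // w _; rewrite !expr0 !mul1r.
rewrite /q; case: ifPn => // g0; rewrite lte_fin Normc.normcM Normc.normcV.
by rewrite ltr_pdivrMr => [/ltW //|]; rewrite lt_neqAle normc_ge0 andbT eq_sym normc_eq0.
Qed.

Lemma sphere_mass f : bergman_sphere f -> rmass f 1 = pi.
Proof.
move=> [fb f1]; have ff := bergman_mass1_fin fb.
have := bergman_norm_sqr f; rewrite f1 expe2 mule1 -(fineK ff) -EFinM => -[E].
by rewrite -[LHS](mulVKf (lt0r_neq0 (pi_gt0 R))) /rmass -E mulr1.
Qed.

(** The infimum stays away from [Num.sqrt (1 - c ^+ 2)] because the improvements of
[ratio_dichotomy] do not depend on the pair of functions. *)
Lemma F_gt c : 0 < c -> c < 1 -> ((Num.sqrt (1 - c ^+ 2))%:E < F c)%E.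
Proof.
move=> c0 c1.
have c21 : c ^+ 2 < 1 by rewrite exprn_ilt1 // ltW.
have c20 : 0 < c ^+ 2 by rewrite exprn_gt0.
pose l := small_mass c.
have l0 : 0 < l ^+ 2.
  rewrite exprn_gt0 // /l /small_mass divr_gt0 ?mulr_gt0 //; lra.
(* A relative gain that both alternatives of the dichotomy exceed, as
   [(1 + m) * (1 - l ^+ 2) < 1] and [(1 - c ^+ 2) * (1 + c ^+ 2) * (1 + m) < 1]. *)
pose m := Num.min (l ^+ 2) (c ^+ 2 * c ^+ 2).
have m0 : 0 < m by rewrite lt_min l0 mulr_gt0.
have [ml mc] : m <= l ^+ 2 /\ m <= c ^+ 2 * c ^+ 2 by rewrite /m !ge_min !lexx orbT.
pose k2 := (1 - c ^+ 2) * (1 + m).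
have k20 : 0 <= k2 by rewrite mulr_ge0 //; lra.
have kk : Num.sqrt k2 ^+ 2 = k2 by rewrite sqr_sqrtr.
apply: (@lt_le_trans _ _ (Num.sqrt k2)%:E).
  rewrite lte_fin ltr_sqrt; last by rewrite /k2 mulr_gt0 //; lra.
  by rewrite /k2 ltr_pMr; lra.
apply: le_ereal_inf_tmp => _ [[f g] [/= fS gS] <-].
rewrite leNgt; apply/negP => sk.
have [fb _] := fS; have [gb _] := gS; have [fan _] := fb; have [gan _] := gb.
have dom := sup_quotient_dominates fan gan (sqrtr_ge0 k2) sk.
have [] := ratio_dichotomy fb gb c0 c1 (pi_gt0 R) (sphere_mass fS) (sphere_mass gS)
  (sqrtr_ge0 k2) dom; rewrite kk /k2 -/l.
  rewrite -mulrA ler_pMr ?subr_gt0 // => h.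
  have := mulr_gt0 m0 l0; lra.
have := mulr_gt0 m0 (mulr_gt0 c20 c20).
set C := c ^+ 2 in mc *; lra.
Qed.

End BergmanRatio.

Theorem theorem5p4 (R : realType) (c : R) (hc0 : 0 < c) (hc1 : c < 1) :
  (F_B c <= (c ^+ 2)%:E)%E /\ ((Num.sqrt (1 - c ^+ 2))%:E < F c)%E.
Proof. by split; [exact: F_B_le|exact: F_gt]. Qed.
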